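(* Let $\rho\in L^1(\mathbb{R}^n)$ be such that $\int_{\mathbb{R}^n}\rho=1$. Then for every $s>0$, every $1\le p\le\infty$ and every $1\le q<\infty$ there exists a finite constant $C$ (depending on $\rho,s,p,q,n$ but not on $f$) such that for every $f\in L^p(\mathbb{R}^n)$ $$\|f\|_{B^{s}_{p,q}}^q\le C\left(\|f\|_{L^p}^q+\int_0^1\frac 1{\varepsilon^{sq+1}}\|f-f\ast\rho_\varepsilon\|_{L^p}^q\, d\varepsilon\right),$$ both sides being considered as elements of $[0,\infty]$.
   Context: For a function $g$ on $\mathbb{R}^n$ and $\varepsilon>0$, $g_\varepsilon(x)=\varepsilon^{-n}g(x/\varepsilon)$. Besov norm. Fix Schwartz functions $\zeta,\varphi\in\mathcal{S}(\mathbb{R}^n)$ with $\operatorname{supp}\widehat\zeta\subset B(0,2)$, $\widehat\zeta\equiv1$ in a neighborhood of $\overline{B}(0,1)$, and $\varphi:=\zeta_{1/2}-\zeta$, so that $\widehat\varphi=\widehat\zeta(\cdot/2)-\widehat\zeta$ and $\operatorname{supp}\widehat\varphi\subset B(0,4)\setminus\overline{B}(0,1)$. The (inhomogeneous) Littlewood-Paley decomposition of a temperate distribution $f$ is $f=\sum_{j\ge0}f_j$ with $f_0=f\ast\zeta$ and $f_j=f\ast\varphi_{2^{1-j}}$ for $j\ge1$. For $f\in L^p$ and $1\le q<\infty$, set $|f|_{B^s_{p,q}}^q=\sum_{j\ge0}2^{sjq}\|f_j\|_{L^p}^q$ and $\|f\|_{B^s_{p,q}}^q=\|f\|_{L^p}^q+|f|_{B^s_{p,q}}^q$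 (possibly $+\infty$); $B^s_{p,q}$ is the set of $f\in L^p$ for which this is finite. *)

(* Defs.v *)
From HB Require Import structures.
From mathcomp Require Import all_boot all_order all_algebra.
From mathcomp Require Import all_classical all_reals all_analysis.
From mathcomp Require Export complex.

Set Implicit Arguments.
Unset Strict Implicit.
Unset Printing Implicit Defensive.
Import Order.TTheory GRing.Theory Num.Theory.
Import numFieldNormedType.Exports.

Local Open Scope classical_set_scope.
Local Open Scope ring_scope.

Definition measure_rV_display : measure_display -> measure_display.
Proof. exact. Qed.

(* The sigma-algebra generated by the coordinates: on 'rV[R]_n, R : realType,
   it is the Borel sigma-algebra. *)
Section measurable_rV.
Context {d} {T : sigmaRingType d}.
Variable n : nat.

Let coors : 'I_n -> 'rV[T]_n -> T := fun i x => x ord0 i.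

Let rV_set0 : g_sigma_preimage coors set0.
Proof. exact: sigma_algebra0. Qed.

Let rV_setC A : g_sigma_preimage coors A -> g_sigma_preimage coors (~` A).
Proof. exact: sigma_algebraC. Qed.

Let rV_bigcup (F : _^nat) : (forall i, g_sigma_preimage coors (F i)) ->
  g_sigma_preimage coors (\bigcup_i (F i)).
Proof. exact: sigma_algebra_bigcup. Qed.

HB.instance Definition _ := @isMeasurable.Build (measure_rV_display d)
  'rV[T]_n (g_sigma_preimage coors) rV_set0 rV_setC rV_bigcup.

End measurable_rV.

Lemma measurable_coord d (T : sigmaRingType d) n (i : 'I_n) :
  measurable_fun [set: 'rV[T]_n] (fun x => x ord0 i).
Proof.
move=> _ Y mY; rewrite setTI; apply: sub_sigma_algebra => /=.
rewrite -bigcup_seq/=; exists i => /=; first by rewrite mem_index_enum.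
by exists Y => //; rewrite setTI.
Qed.

Lemma measurable_fun_rVP d1 d2 (T1 : measurableType d1) (T2 : measurableType d2)
    n (f : T1 -> 'rV[T2]_n) :
  (forall i, measurable_fun [set: T1] (fun x => f x ord0 i)) ->
  measurable_fun [set: T1] f.
Proof.
move=> mf.
have pS : g_sigma_preimage (fun (i : 'I_n) (x : T1) => f x ord0 i) `<=` measurable.
  apply: smallest_sub; first exact: sigma_algebra_measurable.
  case: n => [|n] in f mf *; first by rewrite big_ord0.
  rewrite -bigcup_mkord_ord; apply: bigcup_sub => i Ii.
  by move=> A [B mB <-]; exact: mf.
move=> _ A mA; apply: pS.
rewrite (@g_sigma_preimage_comp _ _ _ 'rV[T2]_n (fun i x => x ord0 i) _ f).
by exists A.
Qed.

Definition cons_rV {T : Type} n (p : T * 'rV[T]_n) : 'rV[T]_n.+1 :=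
  \row_i oapp (p.2 ord0) p.1 (unlift ord0 i).

Lemma measurable_cons_rV d (T : measurableType d) n :
  measurable_fun [set: T * 'rV[T]_n] (@cons_rV T n).
Proof.
apply: measurable_fun_rVP => i; case: (unliftP ord0 i) => [j|] ->.
  have -> : (fun p => @cons_rV T n p ord0 (lift ord0 j)) =
            (fun x : 'rV[T]_n => x ord0 j) \o snd.
    by apply/funext => x; rewrite /= mxE liftK.
  apply: (measurableT_comp (f := fun x : 'rV[T]_n => x ord0 j)) => //.
  exact: measurable_coord.
have -> : (fun p => @cons_rV T n p ord0 ord0) = fst.
  by apply/funext => x; rewrite /= mxE unlift_none.
exact: measurable_fst.
Qed.

Definition uncons_rV {T : Type} n (x : 'rV[T]_n.+1) : T * 'rV[T]_n :=
  (x ord0 ord0, \row_i x ord0 (lift ord0 i)).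

Lemma cons_rVK {T : Type} n : cancel (@cons_rV T n) (@uncons_rV T n).
Proof.
move=> [a x]; rewrite /uncons_rV mxE unlift_none; congr pair.
by apply/rowP => i; rewrite !mxE liftK.
Qed.

Lemma measurable_uncons_rV d (T : measurableType d) n :
  measurable_fun [set: 'rV[T]_n.+1] (@uncons_rV T n).
Proof.
apply/measurable_fun_pair; first exact: measurable_coord.
apply: measurable_fun_rVP => i; under eq_fun do rewrite mxE.
exact: measurable_coord.
Qed.

Section pushforward_product.
Local Open Scope ereal_scope.
Context d1 d2 d3 (T1 : measurableType d1) (T2 : measurableType d2)
  (T3 : measurableType d3) (R : realType).
Variables (m1 : {sigma_finite_measure set T1 -> \bar R})
  (m2 : {sigma_finite_measure set T2 -> \bar R}).
Variables (f : T1 * T2 -> T3) (g : T3 -> T1 * T2).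
Hypotheses (mf : measurable_fun setT f) (mg : measurable_fun setT g).
Hypothesis fK : cancel f g.

Let pm := pushforward (m1 \x m2) f.

Let pm0 : pm set0 = 0. Proof. exact: measure0. Qed.

Let pm_ge0 A : 0 <= pm A. Proof. exact: measure_ge0. Qed.

Let pm_sigma_additive : semi_sigma_additive pm.
Proof. exact: measure_semi_sigma_additive. Qed.

HB.instance Definition _ := isMeasure.Build _ _ _ pm
  pm0 pm_ge0 pm_sigma_additive.

Let pm_sigma_finite : sigma_finite setT pm.
Proof.
have /sigma_finiteP[F [TF ndF Foo]] := sigma_finiteT m1.
have /sigma_finiteP[G [TG ndG Goo]] := sigma_finiteT m2.
exists (fun k => g @^-1` (F k `*` G k)).
  rewrite -preimage_bigcup -(preimage_setT g); congr (_ @^-1` _).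
  rewrite -setXTT TF TG; apply/seteqP; split => [[x y] /=|[x y] /= [k _ []]].
    move=> [/= [i _ Fix] [k _ Gky]]; exists (maxn i k) => //; split.
      by move: x Fix; exact/subsetPset/ndF/leq_maxl.
    by move: y Gky; exact/subsetPset/ndG/leq_maxr.
  by move=> Fx Gy; split; exists k.
move=> k; have [mF Fk] := Foo k; have [mG Gk] := Goo k; split.
  by rewrite -[X in measurable X]setTI; apply: mg => //; exact: measurableX.
rewrite /pm /pushforward -comp_preimage (_ : g \o f = id) ?preimage_id.
  by rewrite product_measure1E// lte_mul_pinfty// ge0_fin_numE.
by apply/funext => x; exact: fK.
Qed.

HB.instance Definition _ := Measure_isSigmaFinite.Build _ _ _ pm
  pm_sigma_finite.

Definition pushforward_product : {sigma_finite_measure set T3 -> \bar R} := pm.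

End pushforward_product.

Section lebesgue_rV.
Variable R : realType.

(* Lebesgue measure on R^0 (a point mass), and on R^(n+1) as the image of the
   product measure on R * R^n. *)
Fixpoint lebesgue_rV n : {sigma_finite_measure set 'rV[R]_n -> \bar R} :=
  match n with
  | 0 => \d_(0 : 'rV[R]_0)
  | n'.+1 => pushforward_product lebesgue_measure (lebesgue_rV n')
      (@measurable_cons_rV _ R n') (@measurable_uncons_rV _ R n')
      (@cons_rVK R n')
  end.

Lemma lebesgue_rV_box n (A : 'I_n -> set R) :
  (forall i, measurable (A i)) ->
  lebesgue_rV n [set x | forall i, A i (x ord0 i)] =
  \big[*%E/1%E]_(i < n) lebesgue_measure (A i).
Proof.
elim: n A => [|n IH] A mA.
  rewrite big_ord0 /= diracE mem_set//.
  by case.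
have mB : measurable [set x : 'rV[R]_n | forall i, A (lift ord0 i) (x ord0 i)].
  rewrite [X in measurable X](_ : _ =
      \bigcap_i ((fun x : 'rV[R]_n => x ord0 i) @^-1` A (lift ord0 i))).
    apply: fin_bigcap_measurable => // i _.
    by rewrite -[X in measurable X]setTI; exact: measurable_coord.
  by apply/seteqP; split => x /= Ax i; [move=> _; exact: Ax|exact: Ax].
rewrite big_ord_recl -IH; last by move=> i; exact: mA.
rewrite -product_measure1E//=; last exact: mA.
rewrite /pushforward; congr (_ _).
apply/seteqP; split => -[a x] /=.
  move=> Ax; split; first by have := Ax ord0; rewrite mxE unlift_none.
  by move=> i; have := Ax (lift ord0 i); rewrite mxE liftK.
by move=> [Aa Ax] i; rewrite mxE; case: unliftP => [j|] ->//=; exact: Ax.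
Qed.

End lebesgue_rV.

Section complex_functions.
Variables (R : realType) (n : nat).
Implicit Types (f g zeta : 'rV[R]_n -> R[i]) (x y xi : 'rV[R]_n).

Definition cintegral f : R[i] :=
  Complex (\int[lebesgue_rV R n]_x complex.Re (f x))%R
          (\int[lebesgue_rV R n]_x complex.Im (f x))%R.

Definition Lpnorm (p : \bar R) f : \bar R :=
  Lnorm (lebesgue_rV R n) p (fun x => (Normc.normc (f x))%:E).

(* Functions are not identified up to a.e. equality; a Borel representative of
   the class is used. *)
Definition mem_Lp (p : \bar R) f : Prop :=
  [/\ measurable_fun setT (fun x => complex.Re (f x)),
      measurable_fun setT (fun x => complex.Im (f x)) &
      (Lpnorm p f < +oo)%E].

(* For f in L^p and g in L^1 the integral converges absolutely for a.e. x; the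
   value at the remaining x is immaterial. *)
Definition convolution f g x : R[i] := cintegral (fun y => f (x - y) * g y).

Definition dilate (e : R) g x : R[i] := real_complex R (e ^- n) * g (e^-1 *: x).

Definition dot x y : R := \sum_i x ord0 i * y ord0 i.

Definition enorm x : R := Num.sqrt (dot x x).

(* Convention: the kernel is exp (- i x.xi). *)
Definition fourier g xi : R[i] :=
  cintegral (fun x => g x * Complex (cos (dot x xi)) (- sin (dot x xi))).

Definition iter_partial (s : seq 'I_n) (h : 'rV[R]_n -> R) : 'rV[R]_n -> R :=
  foldr (fun i k x => 'D_(delta_mx ord0 i) k x) h s.

Definition schwartz_real (h : 'rV[R]_n -> R) : Prop :=
  (forall s x, differentiable (iter_partial s h) x) /\
  (forall (a : 'I_n -> nat) s, exists M : R, forall x,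
     `|(\prod_i x ord0 i ^+ a i) * iter_partial s h x| <= M).

Definition schwartz g : Prop :=
  schwartz_real (fun x => complex.Re (g x)) /\
  schwartz_real (fun x => complex.Im (g x)).

Definition supp (g : 'rV[R]_n -> R[i]) : set 'rV[R]_n :=
  closure [set x | g x != 0].

Definition lp_cutoff zeta : Prop :=
  [/\ schwartz zeta,
      supp (fourier zeta) `<=` [set xi | enorm xi < 2] &
      exists U : set 'rV[R]_n,
        [/\ open U, [set xi | enorm xi <= 1] `<=` U &
            forall xi, U xi -> fourier zeta xi = 1]].

Definition lp_phi zeta x : R[i] := dilate 2^-1 zeta x - zeta x.

(* j.+1 corresponds to the scale 2 ^ (1 - (j + 1)) = 2 ^ (- j) *)
Definition lp_block zeta f (j : nat) : 'rV[R]_n -> R[i] :=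
  match j with
  | 0 => convolution f zeta
  | j'.+1 => convolution f (dilate (2 ^- j') (lp_phi zeta))
  end.

Local Open Scope ereal_scope.

Definition besov_seminorm zeta (s : R) (p : \bar R) (q : R) f : \bar R :=
  (\sum_(0 <= j <oo)
     (2 `^ (s * j%:R * q))%R%:E * Lpnorm p (lp_block zeta f j) `^ q) `^ q^-1.

Definition besov_norm zeta (s : R) (p : \bar R) (q : R) f : \bar R :=
  (Lpnorm p f `^ q + besov_seminorm zeta s p q f `^ q) `^ q^-1.

End complex_functions.

(* Main.v *)
(** Put [chi := zeta_(1/4) - zeta_2].  Since the Fourier transform of [chi] is 1
    on the support of that of [phi], [phi * chi = phi], and [chi] has integral 0.
    Hence, for every [t, e > 0], with [d := t / e],
      [f * phi_t = (f - f * rho_e) * phi_t + (f * phi_t) * (chi_t * rho_e)]  a.e.,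
    and the [L^1] norm of [chi_t * rho_e], which is that of [chi_d * rho], tends
    to 0 with [d] because [chi_d] is, up to its vanishing mass, an approximate
    identity.  As soon as [t <= d0 e] it is at most 1/2, so the last term is
    absorbed and Young's inequality bounds [f * phi_t] by [f - f * rho_e] in
    [L^p].  For [t = 2^-k] this is integrated over the values of [e] in an
    interval [c 2^-k, 2 c 2^-k[; these intervals are disjoint, and lie in ]0, 1[
    except for finitely many [k], for which the [L^p] norm of [f] is enough. *)

Require Import Defs.
From mathcomp Require Import all_boot all_order all_algebra.
From mathcomp Require Import all_classical all_reals all_analysis.
Import Order.TTheory GRing.Theory Num.Theory.
Import numFieldNormedType.Exports.
From mathcomp Require Import measurable_realfun ess_sup_inf ring lra.

Set Implicit Arguments.
Unset Strict Implicit.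
Unset Printing Implicit Defensive.

Local Open Scope classical_set_scope.
Local Open Scope ring_scope.

Local Notation normc := ComplexField.Normc.normc.
Local Notation Re := complex.Re.
Local Notation Im := complex.Im.

(** * Integration of complex-valued functions *)

(** The identity for [f * phi_t] comes from splitting off [(f * rho_e) * phi_t] and replacing
    [phi_t] by [phi_t * chi_t] in it. Absorbing the last term is legitimate only because Young's
    inequality already makes the norm of [f * phi_t] finite. The relation [phi * chi = phi] is
    visible on the Fourier side only. Bringing it back to functions requires injectivity of the
    Fourier transform on [L^1], which is obtained without an inversion formula, from an approximate
    identity built out of [zeta] itself. Both this argument and the smallness of [chi_d * rho] rest
    on one lemma about approximate identities of arbitrary mass, hence on the continuity of
    translations in [L^1], which is carried from boxes to all Borel sets of finite measure by a
    sigma-algebra argument. Functions are concrete representatives and a divergent integral has a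
    default value. Identities that follow from a change of variables therefore hold at every point,
    while those that need Fubini hold where the integrals converge absolutely, hence almost
    everywhere. *)

Section normc_facts.
Variable R : realType.
Implicit Types z w : R[i].

Lemma normcE z : normc z = Num.sqrt (Re z ^+ 2 + Im z ^+ 2).
Proof. by case: z. Qed.

Lemma normc_ge0 z : 0 <= normc z.
Proof. by rewrite normcE sqrtr_ge0. Qed.

Lemma normr_Re_le z : `|Re z| <= normc z.
Proof.
by rewrite normcE -sqrtr_sqr ler_wsqrtr// lerDl sqr_ge0.
Qed.

Lemma normr_Im_le z : `|Im z| <= normc z.
Proof.
by rewrite normcE -sqrtr_sqr ler_wsqrtr// lerDr sqr_ge0.
Qed.

Lemma normc_le_ReIm z : normc z <= `|Re z| + `|Im z|.
Proof.
rewrite normcE -[leRHS]ger0_norm ?addr_ge0// -sqrtr_sqr ler_wsqrtr//.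
rewrite sqrrD !real_normK ?num_real// addrAC lerDl.
by rewrite mulrn_wge0// mulr_ge0.
Qed.

Lemma normcB z w : normc (z - w) <= normc z + normc w.
Proof. by rewrite (le_trans (le_normcD _ _))// normcN. Qed.

Lemma ReM z w : Re (z * w) = Re z * Re w - Im z * Im w.
Proof. by case: z => a b; case: w => c e. Qed.

Lemma ImM z w : Im (z * w) = Re z * Im w + Im z * Re w.
Proof. by case: z => a b; case: w => c e. Qed.

Lemma ReD z w : Re (z + w) = Re z + Re w.
Proof. by case: z => a b; case: w => c e. Qed.

Lemma ImD z w : Im (z + w) = Im z + Im w.
Proof. by case: z => a b; case: w => c e. Qed.

Lemma ReN z : Re (- z) = - Re z.
Proof. by case: z. Qed.

Lemma ImN z : Im (- z) = - Im z.
Proof. by case: z. Qed.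

Lemma normc_real (r : R) : normc (real_complex R r) = `|r|.
Proof. by rewrite normcE /= expr0n/= addr0 sqrtr_sqr. Qed.

Lemma normc_conj z : normc (conjc z) = normc z.
Proof. by case: z => a b; rewrite !normcE /= sqrrN. Qed.

Lemma normc_conjM z w : normc (conjc z * w) = normc z * normc w.
Proof. by rewrite ComplexField.Normc.normcM normc_conj. Qed.

Lemma mulc_conj z : z * conjc z = real_complex R (normc z ^+ 2).
Proof.
case: z => a b; rewrite /= sqr_sqrtr ?addr_ge0 ?sqr_ge0//.
by apply/eqP; rewrite eq_complex/=; apply/andP; split; apply/eqP; ring.
Qed.

End normc_facts.

Section cmeasurable.
Context d (T : measurableType d) (R : realType).
Implicit Types f g : T -> R[i].

Definition cmeasurable f :=
  measurable_fun setT (fun x => Re (f x)) /\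
  measurable_fun setT (fun x => Im (f x)).

Lemma cmeasurable_cst (c : R[i]) : cmeasurable (fun=> c).
Proof. by split; exact: measurable_cst. Qed.

Lemma cmeasurableD f g : cmeasurable f -> cmeasurable g ->
  cmeasurable (fun x => f x + g x).
Proof.
move=> [f1 f2] [g1 g2]; split.
  by under eq_fun do rewrite ReD; exact: measurable_funD.
by under eq_fun do rewrite ImD; exact: measurable_funD.
Qed.

Lemma cmeasurableN f : cmeasurable f -> cmeasurable (fun x => - f x).
Proof.
move=> [f1 f2]; split.
  by under eq_fun do rewrite ReN; exact: measurableT_comp.
by under eq_fun do rewrite ImN; exact: measurableT_comp.
Qed.

Lemma cmeasurableB f g : cmeasurable f -> cmeasurable g ->
  cmeasurable (fun x => f x - g x).
Proof. by move=> mf mg; apply: cmeasurableD => //; exact: cmeasurableN. Qed.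

Lemma cmeasurableM f g : cmeasurable f -> cmeasurable g ->
  cmeasurable (fun x => f x * g x).
Proof.
move=> [f1 f2] [g1 g2]; split.
  under eq_fun do rewrite ReM.
  by apply: measurable_funB; exact: measurable_funM.
under eq_fun do rewrite ImM.
by apply: measurable_funD; exact: measurable_funM.
Qed.

Lemma cmeasurable_conj f : cmeasurable f -> cmeasurable (fun x => conjc (f x)).
Proof.
move=> [f1 f2]; split.
  by rewrite (_ : (fun _ => _) = fun x => Re (f x))//; apply/funext => x; case: (f x).
rewrite (_ : (fun _ => _) = fun x => - Im (f x)); first exact: measurableT_comp.
by apply/funext => x; case: (f x).
Qed.

Lemma measurable_normc f : cmeasurable f ->
  measurable_fun setT (fun x => normc (f x)).
Proof.
move=> [f1 f2]; under eq_fun do rewrite normcE.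
apply: (measurableT_comp (f := @Num.sqrt R)).
  by apply: continuous_measurable_fun; exact: sqrt_continuous.
by apply: measurable_funD; exact: measurable_funX.
Qed.

Lemma measurable_enormc f : cmeasurable f ->
  measurable_fun setT (fun x => (normc (f x))%:E).
Proof. by move=> mf; apply/measurable_EFinP; exact: measurable_normc. Qed.

End cmeasurable.

Lemma cmeasurable_comp d d' (T : measurableType d) (T' : measurableType d')
    (R : realType) (phi : T' -> T) (f : T -> R[i]) :
  measurable_fun setT phi -> cmeasurable f -> cmeasurable (fun x => f (phi x)).
Proof.
move=> mphi [f1 f2]; split.
  exact: (measurableT_comp f1).
exact: (measurableT_comp f2).
Qed.

Section cint.
Context d (T : measurableType d) (R : realType) (mu : {measure set T -> \bar R}).
Implicit Types f g : T -> R[i].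

Definition cintegrable f :=
  cmeasurable f /\ (\int[mu]_x (normc (f x))%:E < +oo)%E.

Definition cint f : R[i] :=
  Complex (\int[mu]_x Re (f x)) (\int[mu]_x Im (f x)).

Lemma cintegrableP f : cintegrable f <->
  mu.-integrable setT (fun x => (Re (f x))%:E) /\
  mu.-integrable setT (fun x => (Im (f x))%:E).
Proof.
split=> [[mf foo]|[/integrableP[m1 i1] /integrableP[m2 i2]]].
  have [m1 m2] := mf.
  split; apply/integrableP; split; (try exact/measurable_EFinP);
    apply: le_lt_trans foo; apply: ge0_le_integral => //=.
  - by do 2 apply: measurableT_comp => //.
  - exact: measurable_enormc.
  - by move=> x _; rewrite lee_fin normr_Re_le.
  - by do 2 apply: measurableT_comp => //.
  - exact: measurable_enormc.
  - by move=> x _; rewrite lee_fin normr_Im_le.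
have mf : cmeasurable f by split; exact/measurable_EFinP.
split=> //.
apply: le_lt_trans (lte_add_pinfty i1 i2).
rewrite -ge0_integralD//; [|exact: measurableT_comp..].
apply: ge0_le_integral => //.
- by move=> x _; rewrite lee_fin normc_ge0.
- exact: measurable_enormc.
- by apply: emeasurable_funD; exact: measurableT_comp.
- by move=> x _; rewrite lee_fin normc_le_ReIm.
Qed.

Lemma eq_cint f g : f =1 g -> cint f = cint g.
Proof. by move=> /funext ->. Qed.

Lemma ae_eq_cint f g : cmeasurable f -> cmeasurable g ->
  {ae mu, forall x, f x = g x} -> cint f = cint g.
Proof.
move=> [f1 f2] [g1 g2] fg; rewrite /cint; congr Complex; congr fine.
- apply: ae_eq_integral => //; [exact/measurable_EFinP..|].
  by apply: filterS fg => x -> .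
- apply: ae_eq_integral => //; [exact/measurable_EFinP..|].
  by apply: filterS fg => x -> .
Qed.

Lemma cintegrable_le f (g : T -> R) : cmeasurable f ->
  measurable_fun setT g -> (forall x, normc (f x) <= g x) ->
  (\int[mu]_x (g x)%:E < +oo)%E -> cintegrable f.
Proof.
move=> mf mg fg goo; split=> //; apply: le_lt_trans goo.
apply: ge0_le_integral => //.
- by move=> x _; rewrite lee_fin normc_ge0.
- exact: measurable_enormc.
- exact/measurable_EFinP.
- by move=> x _; rewrite lee_fin.
Qed.

Lemma cintD f g : cintegrable f -> cintegrable g ->
  cint (fun x => f x + g x) = cint f + cint g.
Proof.
move=> /cintegrableP[f1 f2] /cintegrableP[g1 g2].
rewrite /cint; apply/eqP; rewrite eq_complex /=; apply/andP; split; apply/eqP.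
  by rewrite -RintegralD//; congr fine; apply: eq_integral => x _; rewrite ReD.
by rewrite -RintegralD//; congr fine; apply: eq_integral => x _; rewrite ImD.
Qed.

Lemma cintegrableZ (c : R[i]) f : cintegrable f -> cintegrable (fun x => c * f x).
Proof.
move=> [mf foo]; split; first by apply: cmeasurableM => //; exact: cmeasurable_cst.
under eq_integral do rewrite ComplexField.Normc.normcM EFinM.
rewrite ge0_integralZl//.
- by rewrite lte_mul_pinfty// lee_fin normc_ge0.
- exact: measurable_enormc.
- by move=> x _; rewrite lee_fin normc_ge0.
- by rewrite lee_fin normc_ge0.
Qed.

Lemma cintZ (c : R[i]) f : cintegrable f -> cint (fun x => c * f x) = c * cint f.
Proof.
move=> /cintegrableP[f1 f2].
have iZ (r : R) (h : T -> R) : mu.-integrable setT (fun x => (h x)%:E) ->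
    mu.-integrable setT (EFin \o (fun x => r * h x)).
  by move=> /(integrableZl measurableT r); congr (_.-integrable _ _).
apply/eqP; rewrite eq_complex ReM ImM /=; apply/andP; split; apply/eqP.
  rewrite -!RintegralZl// -RintegralB//; [|exact: iZ..].
  by congr fine; apply: eq_integral => x _; rewrite ReM.
rewrite -!RintegralZl// -RintegralD//; [|exact: iZ..].
by congr fine; apply: eq_integral => x _; rewrite ImM.
Qed.

Lemma cintegrableN f : cintegrable f -> cintegrable (fun x => - f x).
Proof.
move=> /(cintegrableZ (-1)); congr cintegrable.
by apply/funext => x; rewrite mulN1r.
Qed.

Lemma cintN f : cintegrable f -> cint (fun x => - f x) = - cint f.
Proof.
move=> fi; rewrite -mulN1r -cintZ//.
by apply: eq_cint => x; rewrite mulN1r.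
Qed.

Lemma cintB f g : cintegrable f -> cintegrable g ->
  cint (fun x => f x - g x) = cint f - cint g.
Proof.
by move=> fi gi; rewrite cintD ?cintN//; exact: cintegrableN.
Qed.

(* Multiplying [f] by [conjc (cint f)] makes its integral real. *)
Lemma normc_cint_le f : cmeasurable f ->
  ((normc (cint f))%:E <= \int[mu]_x (normc (f x))%:E)%E.
Proof.
move=> mf.
have [foo|] := ltP (\int[mu]_x (normc (f x))%:E)%E +oo%E; last first.
  by rewrite leye_eq => /eqP ->; rewrite leey.
have fi : cintegrable f by [].
have [c cE] : {c | c = cint f} by exists (cint f).
rewrite -cE.
have [c0|c0] := eqVneq (normc c) 0.
  by rewrite c0; apply: integral_ge0 => x _; rewrite lee_fin normc_ge0.
have cp : 0 < normc c by rewrite lt_neqAle eq_sym c0 normc_ge0.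
rewrite -(@lee_pmul2l _ (normc c)%:E) ?lte_fin//.
rewrite -EFinM -expr2 -ge0_integralZl//; last 3 first.
- exact: measurable_enormc.
- by move=> x _; rewrite lee_fin normc_ge0.
- by rewrite lee_fin normc_ge0.
have -> : normc c ^+ 2 = Re (conjc c * c) by rewrite mulrC mulc_conj.
rewrite [X in _ * X]cE -cintZ//= /Rintegral.
have [cf _] := (cintegrableP _).1 (cintegrableZ (conjc c) fi).
rewrite fineK; last exact: integrable_fin_num.
apply: le_trans (lee_abs _) _.
apply: le_trans (le_abse_integral _ _ _) _ => //.
  by case/integrableP: cf.
apply: ge0_le_integral => //.
- by case/integrableP: cf => ? _; exact: measurableT_comp.
- by apply/measurable_EFinP; apply: measurable_funM => //; exact: measurable_normc.
move=> x _; rewrite lee_fin (le_trans (normr_Re_le _))//.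
by rewrite normc_conjM.
Qed.

End cint.

(** * Complex integrals under a map that pushes [m1] forward to [k] times [m2] *)

Section change_of_variables.
Context d1 d2 (T1 : measurableType d1) (T2 : measurableType d2) (R : realType).
Variables (m1 : {measure set T1 -> \bar R}) (m2 : {measure set T2 -> \bar R}).
Variables (phi : T1 -> T2) (k : R).
Hypothesis k0 : 0 < k.
Hypothesis mphi : measurable_fun setT phi.
Hypothesis ge0_phi : forall F : T2 -> \bar R, measurable_fun setT F ->
  (forall y, 0 <= F y)%E -> (\int[m1]_x F (phi x) = k%:E * \int[m2]_y F y)%E.

Lemma cintegrable_change f : cintegrable m2 f -> cintegrable m1 (f \o phi).
Proof.
move=> [mf foo]; split; first exact: cmeasurable_comp.
rewrite (ge0_phi (F := fun y => (normc (f y))%:E)).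
- by rewrite lte_mul_pinfty ?lee_fin 1?ltW.
- exact: measurable_enormc.
- by move=> y; rewrite lee_fin normc_ge0.
Qed.

(** Valid also for divergent integrals: multiplying by [k > 0] does not change which of the positive
    and negative parts have infinite integral, so [fine] yields its default value 0 on both sides at
    once. *)
Let fine_change (h : T2 -> R) : measurable_fun setT h ->
  fine (\int[m1]_x (h (phi x))%:E) = k * fine (\int[m2]_y (h y)%:E).
Proof.
move=> mh.
have mH : measurable_fun setT (fun y => (h y)%:E) by exact/measurable_EFinP.
rewrite integralE [in RHS]integralE.
rewrite [X in (X - _)%E](_ : _ = \int[m1]_x (fun y => (h y)%:E)^\+%E (phi x))%E; last first.
  by apply: eq_integral => x _; rewrite !funeposE.
rewrite [X in (_ - X)%E](_ : _ = \int[m1]_x (fun y => (h y)%:E)^\-%E (phi x))%E; last first.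
  by apply: eq_integral => x _; rewrite !funenegE.
rewrite (ge0_phi (F := (fun y => (h y)%:E)^\+%E)); [|exact: measurable_funepos|by []].
rewrite (ge0_phi (F := (fun y => (h y)%:E)^\-%E)); [|exact: measurable_funeneg|by []].
have kp : (0 < k%:E)%E by rewrite lte_fin.
case: (\int[m2]_y _)%E => [r| |]; case: (\int[m2]_y _)%E => [r'| |];
  by rewrite /= ?gt0_muley ?gt0_muleNy//= ?mulrBr ?mulr0.
Qed.

Lemma cint_change f : cmeasurable f ->
  cint m1 (f \o phi) = real_complex R k * cint m2 f.
Proof.
move=> [f1 f2]; apply/eqP; rewrite eq_complex ReM ImM /=.
rewrite /Rintegral; have /= -> := fine_change f1; have /= -> := fine_change f2.
by rewrite !mul0r subr0 addr0 !eqxx.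
Qed.

End change_of_variables.

(** * Affine changes of variables in Lebesgue integrals *)

Lemma ge0_integral_pushforward_product d1 d2 d3 (T1 : measurableType d1)
    (T2 : measurableType d2) (T3 : measurableType d3) (R : realType)
    (m1 : {sigma_finite_measure set T1 -> \bar R})
    (m2 : {sigma_finite_measure set T2 -> \bar R})
    (f : T1 * T2 -> T3) (g : T3 -> T1 * T2) (mf : measurable_fun setT f)
    (mg : measurable_fun setT g) (fK : cancel f g) (F : T3 -> \bar R) :
  measurable_fun setT F -> (forall x, 0 <= F x)%E ->
  (\int[pushforward_product m1 m2 mf mg fK]_x F x =
   \int[m1]_x \int[m2]_y F (f (x, y)))%E.
Proof.
move=> mF F0.
rewrite [LHS](_ : _ = \int[pushforward (m1 \x m2) f]_x F x)%E//.
rewrite ge0_integral_pushforward//.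
rewrite preimage_setT fubini_tonelli1//.
  exact: (measurableT_comp mF mf).
by move=> p; exact: F0.
Qed.

Section lebesgue_affine.
Variable R : realType.
Local Notation mu := (@lebesgue_measure R).

Lemma measurable_affine1 (c a : R) :
  measurable_fun [set: measurableTypeR R]
    (fun t : measurableTypeR R => c * t + a : measurableTypeR R).
Proof. by apply: measurable_funD => //; exact: measurable_funM. Qed.

(** Uniqueness of Lebesgue measure: [|c|] times its image under [t |-> c * t + a] gives every
    interval []u, v]] its length. For [c < 0] the preimage is closed on the left instead of the
    right, with the same length. *)
Lemma ge0_integral_lebesgue_affine (c a : R) (F : measurableTypeR R -> \bar R) : c != 0 ->
  measurable_fun setT F -> (forall t, 0 <= F t)%E ->
  (\int[mu]_t F (c * t + a)%R = (`|c|^-1)%:E * \int[mu]_t F t)%E.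
Proof.
move=> c0 mF F0.
have cp : 0 <= `|c| by [].
pose phi : measurableTypeR R -> measurableTypeR R := fun t => c * t + a.
have mphi : measurable_fun setT phi := measurable_affine1 c a.
pose pm : {measure set (measurableTypeR R) -> \bar R} :=
  measure_function_pushforward__canonical__measure_function_Measure mu mphi.
pose m := mscale (NngNum cp) pm.
have mE (A : set (measurableTypeR R)) : measurable A -> mu A = m A.
  apply: lebesgue_measure_unique => _ [[u v] _ <-].
  change (mu `]u, v]%classic = `|c|%:E * mu (phi @^-1` `]u, v]%classic))%E.
  have [cgt0|clt0|c00] := ltrgtP c 0; last by rewrite c00 eqxx in c0.
    rewrite (_ : _ @^-1` _ = `[(v - a) / c, (u - a) / c[%classic); last first.
      apply/seteqP; split => t /=; rewrite /phi !in_itv/=.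
        by rewrite ler_ndivrMr// ltr_ndivlMr//; lra.
      by rewrite ler_ndivrMr// ltr_ndivlMr//; lra.
    rewrite !lebesgue_measure_itv/= !lte_fin ltr_nM2r ?invr_lt0// ltrD2r.
    case: ifP => uv; last by rewrite mule0.
    by rewrite -!EFinB -EFinM ltr0_norm//; congr EFin; field.
  rewrite (_ : _ @^-1` _ = `](u - a) / c, (v - a) / c]%classic); last first.
    apply/seteqP; split => t /=; rewrite /phi !in_itv/=.
      by rewrite ler_pdivlMr// ltr_pdivrMr//; lra.
    by rewrite ler_pdivlMr// ltr_pdivrMr//; lra.
  rewrite !lebesgue_measure_itv/= !lte_fin ltr_pM2r ?invr_gt0// ltrD2r.
  case: ifP => uv; last by rewrite mule0.
  by rewrite -!EFinB -EFinM gtr0_norm//; congr EFin; field.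
rewrite [X in (_ = _ * X)%E](eq_measure_integral m); last by move=> A mA _; exact: mE.
rewrite ge0_integral_mscale// ge0_integral_pushforward//=.
by rewrite muleA -EFinM mulVf ?normr_eq0// mul1e.
Qed.

Lemma measurable_fun_affine_rV n (c : R) (a : 'rV[R]_n) :
  measurable_fun setT (fun x : 'rV[R]_n => c *: x + a).
Proof.
apply: measurable_fun_rVP => i; under eq_fun do rewrite !mxE.
by apply: measurable_funD => //; apply: measurable_funM => //; exact: measurable_coord.
Qed.

Lemma ge0_integral_lebesgue_rVS n (F : 'rV[R]_n.+1 -> \bar R) :
  measurable_fun setT F -> (forall x, 0 <= F x)%E ->
  (\int[lebesgue_rV R n.+1]_x F x =
   \int[mu]_t \int[lebesgue_rV R n]_x F (cons_rV (t, x)))%E.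
Proof.
move=> mF F0.
exact: (ge0_integral_pushforward_product mu (lebesgue_rV R n)
  (@measurable_cons_rV _ R n) (@measurable_uncons_rV _ R n) (@cons_rVK R n)).
Qed.

(** Induction on the dimension: the first coordinate and the vector of the others undergo affine
    maps with the same factor, so each coordinate contributes one [|c|^-1]. *)
Lemma ge0_integral_lebesgue_rV_affine n (c : R) (a : 'rV[R]_n)
    (F : 'rV[R]_n -> \bar R) : c != 0 ->
  measurable_fun setT F -> (forall x, 0 <= F x)%E ->
  (\int[lebesgue_rV R n]_x F (c *: x + a)%R =
   (`|c| ^- n)%:E * \int[lebesgue_rV R n]_x F x)%E.
Proof.
move=> c0; elim: n a F => [|n IH] a F mF F0.
  rewrite expr0 invr1 mul1e; apply: eq_integral => x _; congr F.
  by apply/rowP => -[].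
have mFc t : measurable_fun setT (fun x : 'rV[R]_n => F (cons_rV (t, x))).
  apply: measurableT_comp => //.
  by apply: (measurableT_comp (@measurable_cons_rV _ _ n)).
rewrite !ge0_integral_lebesgue_rVS//; last first.
  by apply: measurableT_comp => //; exact: measurable_fun_affine_rV.
pose a' := \row_i a ord0 (lift ord0 i).
have E t x : c *: cons_rV (t, x) + a = cons_rV (c * t + a ord0 ord0, c *: x + a').
  apply/rowP => i; rewrite !mxE; case: (unliftP ord0 i) => [j|] -> /=.
    by rewrite !mxE.
  by [].
pose G t := (\int[lebesgue_rV R n]_x F (cons_rV (t, x)))%E.
have G0 t : (0 <= G t)%E by exact: integral_ge0.
have mG : measurable_fun setT G.
  apply: (@measurable_fun_fubini_tonelli_F _ _ _ _ _ _ (fun p => F (cons_rV p))) => //.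
  by apply: measurableT_comp => //; exact: measurable_cons_rV.
transitivity (\int[mu]_t ((`|c| ^- n)%:E * G (c * t + a ord0 ord0)%R))%E.
  apply: eq_integral => t _; under eq_integral do rewrite E.
  exact: (IH a' (fun x => F (cons_rV (c * t + a ord0 ord0, x)))).
have mGa : measurable_fun setT (fun t : measurableTypeR R => G (c * t + a ord0 ord0)%R).
  exact: (measurableT_comp mG (measurable_affine1 c (a ord0 ord0))).
rewrite (ge0_integralZl _ measurableT mGa); last 2 first.
- by move=> t _; exact: G0.
- by rewrite lee_fin invr_ge0 exprn_ge0.
rewrite (@ge0_integral_lebesgue_affine c (a ord0 ord0) G c0 mG G0) muleA -EFinM; congr (_ * _)%E.
by rewrite exprSr invfM.
Qed.

End lebesgue_affine.

Section cint_extra.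
Context d (T : measurableType d) (R : realType) (mu : {measure set T -> \bar R}).

Let fineZ (r : R) (h : T -> R) : 0 < r -> measurable_fun setT h ->
  fine (\int[mu]_x (r * h x)%:E) = r * fine (\int[mu]_x (h x)%:E).
Proof.
move=> r0 mh.
have mH : measurable_fun setT (fun y => (h y)%:E) by exact/measurable_EFinP.
rewrite integralE [in RHS]integralE.
have -> : (fun x => (r * h x)%:E) = (fun x => r%:E * (h x)%:E)%E.
  by apply/funext => x; rewrite EFinM.
rewrite ge0_funeposM ?ge0_funenegM; [|exact: ltW..].
rewrite !ge0_integralZl//; [|exact: measurable_funeneg|by rewrite lee_fin ltW
  |exact: measurable_funepos|by rewrite lee_fin ltW].
have kp : (0 < r%:E)%E by rewrite lte_fin.
case: (\int[mu]_y _)%E => [a| |]; case: (\int[mu]_y _)%E => [b| |];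
  by rewrite /= ?gt0_muley ?gt0_muleNy//= ?mulrBr ?mulr0.
Qed.

Lemma cint_realZ (r : R) (f : T -> R[i]) : 0 < r -> cmeasurable f ->
  cint mu (fun x => real_complex R r * f x) = real_complex R r * cint mu f.
Proof.
move=> r0 [f1 f2]; apply/eqP; rewrite eq_complex ReM ImM /=.
rewrite !mul0r subr0 addr0 /Rintegral -!fineZ//.
apply/andP; split; apply/eqP; congr fine; apply: eq_integral => x _.
  by rewrite ReM /= mul0r subr0.
by rewrite ImM /= mul0r addr0.
Qed.

(** If [c = 0] both sides vanish, otherwise [f] is integrable too. In Fubini arguments the constant
    may vanish exactly where the remaining integral diverges. *)
Lemma cintZ_weak (c : R[i]) (f : T -> R[i]) :
  cintegrable mu (fun x => c * f x) -> cint mu (fun x => c * f x) = c * cint mu f.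
Proof.
have [->|c0] := eqVneq c 0 => fi.
  rewrite mul0r; under [LHS]eq_cint do rewrite mul0r.
  by rewrite /cint /Rintegral integral0.
rewrite -cintZ//; have := cintegrableZ c^-1 fi; congr cintegrable.
by apply/funext => x; rewrite mulrA mulVf// mul1r.
Qed.

End cint_extra.

(** * Integrals depending on a parameter, and Fubini's theorem for complex-valued functions *)

Lemma measurable_Rintegral_param d1 d2 (T1 : measurableType d1)
    (T2 : measurableType d2) (R : realType)
    (m2 : {sigma_finite_measure set T2 -> \bar R}) (h : T1 * T2 -> R) :
  measurable_fun setT h -> measurable_fun setT (fun x => \int[m2]_y h (x, y)).
Proof.
move=> mh; have mH : measurable_fun setT (EFin \o h) by exact/measurable_EFinP.
apply: (measurableT_comp (f := @fine R)) => //=.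
(* Tonelli applies to the positive and negative parts separately, so parameters at which the
   integral diverges are covered. *)
rewrite (_ : (fun _ => _) = (fun x => fubini_F m2 (EFin \o h)^\+%E x -
    fubini_F m2 (EFin \o h)^\-%E x)%E); last first.
  apply/funext => x; rewrite integralE /fubini_F; congr (_ - _)%E.
    by apply: eq_integral => y _; rewrite !funeposE.
  by apply: eq_integral => y _; rewrite !funenegE.
apply: emeasurable_funB; apply: measurable_fun_fubini_tonelli_F => //.
  exact: measurable_funepos.
exact: measurable_funeneg.
Qed.

Lemma measurable_swap d1 d2 (T1 : measurableType d1) (T2 : measurableType d2) :
  measurable_fun setT (fun p : T2 * T1 => (p.2, p.1)).
Proof. by apply/measurable_fun_pair; [exact: measurable_snd|exact: measurable_fst]. Qed.

Section cint_fubini.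
Context d1 d2 (T1 : measurableType d1) (T2 : measurableType d2) (R : realType).
Variables (m1 : {sigma_finite_measure set T1 -> \bar R}).
Variables (m2 : {sigma_finite_measure set T2 -> \bar R}).

Lemma cmeasurable_cint (F : T1 * T2 -> R[i]) : cmeasurable F ->
  cmeasurable (fun x => cint m2 (fun y => F (x, y))).
Proof.
move=> [F1 F2]; split; [exact: (measurable_Rintegral_param m2 F1)|
  exact: (measurable_Rintegral_param m2 F2)].
Qed.

(** The real inner integrals are [fine] of the extended ones; they agree wherever the section is
    integrable, hence almost everywhere. *)
Let Rint_fubini (h : T1 * T2 -> R) :
  (m1 \x m2)%E.-integrable setT (fun z => (h z)%:E) ->
  \int[m1]_x \int[m2]_y h (x, y) = \int[m2]_y \int[m1]_x h (x, y).
Proof.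
move=> hi; rewrite /Rintegral; congr fine.
have mh := measurable_int _ hi.
transitivity (\int[m1]_x \int[m2]_y (h (x, y))%:E)%E.
  apply: ae_eq_integral => //.
  - by apply/measurable_EFinP; apply: measurable_Rintegral_param; exact/measurable_EFinP.
  - exact: (measurable_fubini_F hi).
  - apply: filterS (ae_integrable1 hi) => x xi _.
    by rewrite fineK//; exact: integrable_fin_num.
rewrite (Fubini hi); apply/esym; apply: ae_eq_integral => //.
- apply/measurable_EFinP.
  apply: (measurable_Rintegral_param m1 (h := fun p => h (p.2, p.1))).
  by apply: (measurableT_comp (f := h)); [exact/measurable_EFinP|exact: measurable_swap].
- exact: (measurable_fubini_G hi).
- apply: filterS (ae_integrable2 hi) => x xi _.
  by rewrite fineK//; exact: integrable_fin_num.
Qed.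

Lemma cint_fubini (F : T1 * T2 -> R[i]) : cintegrable (m1 \x m2)%E F ->
  cint m1 (fun x => cint m2 (fun y => F (x, y))) =
  cint m2 (fun y => cint m1 (fun x => F (x, y))).
Proof.
move=> /cintegrableP[F1 F2]; rewrite /cint /=; congr Complex.
  exact: (Rint_fubini F1).
exact: (Rint_fubini F2).
Qed.

Lemma ae_cintegrable1 (F : T1 * T2 -> R[i]) : cintegrable (m1 \x m2)%E F ->
  {ae m1, forall x, cintegrable m2 (fun y => F (x, y))}.
Proof.
move=> /cintegrableP[F1 F2].
apply: filterS2 (ae_integrable1 F1) (ae_integrable1 F2) => x h1 h2.
exact/cintegrableP.
Qed.

Lemma ae_cintegrable2 (F : T1 * T2 -> R[i]) : cintegrable (m1 \x m2)%E F ->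
  {ae m2, forall y, cintegrable m1 (fun x => F (x, y))}.
Proof.
move=> /cintegrableP[F1 F2].
apply: filterS2 (ae_integrable2 F1) (ae_integrable2 F2) => x h1 h2.
exact/cintegrableP.
Qed.

End cint_fubini.

(** * Convolution and Young's inequality *)

Section Lnorm_facts.
Context d (T : measurableType d) (R : realType) (mu : {measure set T -> \bar R}).
Local Open Scope ereal_scope.

Lemma gt0_le_poweR (r : R) (x y : \bar R) : (0 < r)%R -> 0 <= x -> x <= y ->
  x `^ r <= y `^ r.
Proof.
move=> r0 x0 xy; apply: gt0_ler_poweR => //; first exact: ltW.
  by rewrite in_itv/= x0 leey.
by rewrite in_itv/= (le_trans x0 xy) leey.
Qed.

Lemma measurable_abse_poweR (f : T -> \bar R) (r : R) : measurable_fun setT f ->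
  measurable_fun setT (fun x => `|f x| `^ r).
Proof.
move=> mf; apply: (measurableT_comp (measurable_poweR r)).
exact: measurableT_comp.
Qed.

Lemma ae_le_Lnorm (f g : T -> \bar R) p : 1 <= p ->
  measurable_fun setT f -> measurable_fun setT g ->
  {ae mu, forall x, `|f x| <= `|g x|} -> Lnorm mu p f <= Lnorm mu p g.
Proof.
case: p => [r| |]//; last 1 first.
  move=> _ _ _ fg; rewrite unlock /Lnorm; case: ifP => // _.
  exact: le_ess_sup.
rewrite lee_fin => r1 mf mg fg; rewrite unlock /Lnorm.
have r0 : (0 < r)%R by exact: lt_le_trans r1.
apply: gt0_le_poweR; first by rewrite invr_gt0.
  by apply: integral_ge0 => x _; exact: poweR_ge0.
apply: ae_ge0_le_integral => //.
- by move=> x _; exact: poweR_ge0.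
- exact: measurable_abse_poweR.
- by move=> x _; exact: poweR_ge0.
- exact: measurable_abse_poweR.
- by apply: filterS fg => x fg _; exact: gt0_le_poweR.
Qed.

Lemma le_Lnorm (f g : T -> \bar R) p : 1 <= p ->
  measurable_fun setT f -> measurable_fun setT g ->
  (forall x, `|f x| <= `|g x|) -> Lnorm mu p f <= Lnorm mu p g.
Proof. by move=> p1 mf mg fg; apply: ae_le_Lnorm => //; exact: aeW. Qed.

Lemma ae_eq_Lnorm (f g : T -> \bar R) p : 1 <= p ->
  measurable_fun setT f -> measurable_fun setT g ->
  {ae mu, forall x, f x = g x} -> Lnorm mu p f = Lnorm mu p g.
Proof.
by move=> p1 mf mg fg; apply/eqP; rewrite eq_le !ae_le_Lnorm//;
  apply: filterS fg => x ->.
Qed.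

Lemma Lnorm_lty_ae (f : T -> \bar R) p : 1 <= p -> measurable_fun setT f ->
  Lnorm mu p f < +oo -> {ae mu, forall x, `|f x| < +oo}.
Proof.
case: p => [r| |]//; last first.
  move=> _ mf; rewrite unlock /Lnorm; case: ifPn => [_ foo|].
    by apply: filterS (ess_sup_ge mu (abse \o f)) => x /= /le_lt_trans; exact.
  (* For [p = +oo], [Lnorm] is 0 by convention on a space of measure 0; every property then holds
     almost everywhere. *)
  rewrite -leNgt measure_le0 => /eqP mu0 _.
  by exists setT; split.
rewrite lee_fin => r1 mf.
have r0 : (0 < r)%R by exact: lt_le_trans r1.
rewrite unlock /Lnorm => /lty_poweRy; rewrite invr_eq0 gt_eqF// => /(_ isT) foo.
have : mu.-integrable setT (fun x => `|f x| `^ r).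
  apply/integrableP; split; first exact: measurable_abse_poweR.
  by under eq_integral do rewrite gee0_abs ?poweR_ge0//.
move=> /(integrable_ae measurableT); apply: filterS => x /(_ I) h.
apply: (@lty_poweRy _ _ r); first by rewrite gt_eqF.
by rewrite -ge0_fin_numE ?poweR_ge0.
Qed.

End Lnorm_facts.

Section young.
Variables (R : realType) (n : nat).
Local Notation V := 'rV[R]_n.
Local Notation mu := (lebesgue_rV R n).
Local Open Scope ereal_scope.

Lemma measurable_subrV : measurable_fun setT (fun p : V * V => (p.1 - p.2)%R).
Proof.
apply: measurable_fun_rVP => i; under eq_fun do rewrite !mxE.
by apply: measurable_funB; apply: (measurableT_comp (measurable_coord i)).
Qed.

Lemma measurable_subrVl (x : V) : measurable_fun setT (fun y : V => (x - y)%R).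
Proof.
by have := measurable_fun_affine_rV (-1) x; congr measurable_fun;
  apply/funext => y; rewrite scaleN1r addrC.
Qed.

Lemma measurable_addrVr (y : V) : measurable_fun setT (fun x : V => (x + y)%R).
Proof.
by have := measurable_fun_affine_rV 1 y; congr measurable_fun;
  apply/funext => x; rewrite scale1r.
Qed.

Lemma ge0_integral_rV_reflect (x : V) (F : V -> \bar R) : measurable_fun setT F ->
  (forall y, 0 <= F y) -> \int[mu]_y F (x - y)%R = \int[mu]_y F y.
Proof.
move=> mF F0.
have := @ge0_integral_lebesgue_rV_affine _ n (-1) x F; rewrite oppr_eq0 oner_eq0.
move=> /(_ isT mF F0); rewrite normrN1 expr1n invr1 mul1e => <-.
by apply: eq_integral => y _; rewrite scaleN1r addrC.
Qed.

Lemma ge0_integral_rV_translate (y : V) (F : V -> \bar R) : measurable_fun setT F ->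
  (forall y, 0 <= F y) -> \int[mu]_x F (x + y)%R = \int[mu]_x F x.
Proof.
move=> mF F0.
have := @ge0_integral_lebesgue_rV_affine _ n 1 y F; rewrite oner_eq0.
move=> /(_ isT mF F0); rewrite normr1 expr1n invr1 mul1e => <-.
by apply: eq_integral => x _; rewrite scale1r.
Qed.

Lemma lebesgue_rV_reflect (x : V) (N : set V) : measurable N ->
  mu ((fun y => x - y)%R @^-1` N) = mu N.
Proof.
move=> mN.
have E (A : set V) : measurable A -> mu A = \int[mu]_y (\1_A y)%:E.
  by move=> mA; rewrite integral_indic// setIT.
rewrite E; last by rewrite -[X in measurable X]setTI; exact: measurable_subrVl.
rewrite (E _ mN); apply: (ge0_integral_rV_reflect x (F := fun z => (\1_N z)%:E)).
  exact/measurable_EFinP.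
by move=> y; rewrite lee_fin.
Qed.

Lemma measurable_conv_kernel (F G : V -> R) :
  measurable_fun setT F -> measurable_fun setT G ->
  measurable_fun setT (fun p : V * V => (F (p.1 - p.2) * G p.2)%R).
Proof.
move=> mF mG; apply: measurable_funM.
  exact: (measurableT_comp mF measurable_subrV).
exact: (measurableT_comp mG).
Qed.

Lemma measurable_conv_kernel1 (F G : V -> R) (x : V) :
  measurable_fun setT F -> measurable_fun setT G ->
  measurable_fun setT (fun y : V => (F (x - y) * G y)%R).
Proof.
move=> mF mG; apply: measurable_funM => //.
exact: (measurableT_comp mF (measurable_subrVl x)).
Qed.

(** Convolution of nonnegative functions, with extended values so that it makes sense where it
    diverges. Its finiteness at [x], for the moduli of two complex functions, is the absolute
    convergence of their [convolution] at [x]. *)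
Definition econv (F G : V -> R) (x : V) := \int[mu]_y (F (x - y) * G y)%:E.

Lemma measurable_econv (F G : V -> R) :
  measurable_fun setT F -> measurable_fun setT G ->
  (forall x, 0 <= F x)%R -> (forall x, 0 <= G x)%R ->
  measurable_fun setT (econv F G).
Proof.
move=> mF mG F0 G0.
apply: (@measurable_fun_fubini_tonelli_F _ _ _ _ _ mu
  (fun p : V * V => (F (p.1 - p.2) * G p.2)%:E)).
  by apply/measurable_EFinP; exact: measurable_conv_kernel.
by move=> p; rewrite lee_fin mulr_ge0.
Qed.

Lemma econv_ge0 (F G : V -> R) x :
  (forall x, 0 <= F x)%R -> (forall x, 0 <= G x)%R -> 0 <= econv F G x.
Proof. by move=> F0 G0; apply: integral_ge0 => y _; rewrite lee_fin mulr_ge0. Qed.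

Lemma integral_econv (F G : V -> R) :
  measurable_fun setT F -> measurable_fun setT G ->
  (forall x, 0 <= F x)%R -> (forall x, 0 <= G x)%R ->
  \int[mu]_x econv F G x = \int[mu]_x (F x)%:E * \int[mu]_x (G x)%:E.
Proof.
move=> mF mG F0 G0.
rewrite (fubini_tonelli (fun p : V * V => (F (p.1 - p.2) * G p.2)%:E))/=.
- rewrite -ge0_integralZl//; last 3 first.
  + exact/measurable_EFinP.
  + by move=> x _; rewrite lee_fin.
  + by apply: integral_ge0 => x _; rewrite lee_fin.
  apply: eq_integral => y _; under eq_integral do rewrite EFinM.
  rewrite ge0_integralZr//.
  + congr (_ * _); rewrite (ge0_integral_rV_translate (- y)%R (F := fun x => (F x)%:E))//.
      exact/measurable_EFinP.
  + by apply/measurable_EFinP; apply: (measurableT_comp mF); exact: measurable_addrVr.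
  + by move=> x _; rewrite lee_fin.
  + by rewrite lee_fin.
- by apply/measurable_EFinP; exact: measurable_conv_kernel.
- by move=> p; rewrite lee_fin mulr_ge0.
Qed.

(** For [p = +oo], [F (x - y)] is at most the essential supremum for [y] outside the reflection of a
    null set, which is null. For a finite exponent [r], Hölder's inequality bounds the [r]-th power
    of the convolution pointwise, and Tonelli integrates the bound. *)
Lemma young_econv (F G : V -> R) p : 1 <= p ->
  measurable_fun setT F -> measurable_fun setT G ->
  (forall x, 0 <= F x)%R -> (forall x, 0 <= G x)%R ->
  Lnorm mu p (EFin \o F) < +oo -> \int[mu]_x (G x)%:E < +oo ->
  Lnorm mu p (econv F G) <= Lnorm mu p (EFin \o F) * \int[mu]_x (G x)%:E.
Proof.
move=> p1 mF mG F0 G0 Foo Goo.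
have Gge0 : 0 <= \int[mu]_x (G x)%:E.
  by apply: integral_ge0 => x _; rewrite lee_fin.
case: p p1 Foo => [r| |]//; last first.
  move=> _; rewrite unlock /Lnorm; case: ifPn => [mu0 Foo|]; last by rewrite mul0e.
  have M0 : 0 <= ess_sup mu (abse \o (EFin \o F)).
    by apply: ess_sup_gee => //; apply: aeW => x; exact: abse_ge0.
  apply/ess_supP; apply: aeW => x /=.
  rewrite gee0_abs ?econv_ge0// -ge0_integralZl//; last 2 first.
    exact/measurable_EFinP.
    by move=> y _; rewrite lee_fin.
  apply: ae_ge0_le_integral => //.
  - by move=> y _; rewrite lee_fin mulr_ge0.
  - by apply/measurable_EFinP; exact: measurable_conv_kernel1.
  - by move=> y _; rewrite mule_ge0// lee_fin.
  - by apply: measurable_funeM; exact/measurable_EFinP.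
  have [N [mN N0 FN]] := ess_sup_ge mu (abse \o (EFin \o F)).
  exists ((fun y => (x - y)%R) @^-1` N); split.
  - by rewrite -[X in measurable X]setTI; exact: measurable_subrVl.
  - exact: (etrans (lebesgue_rV_reflect x mN) N0).
  - move=> y /= /not_implyP[_ ny]; apply: FN => /= h; apply: ny.
    rewrite EFinM lee_wpmul2r ?lee_fin//; apply: le_trans h.
    by rewrite ger0_norm.
rewrite lee_fin => r1 Foo.
have r0 : (0 < r)%R by exact: lt_le_trans r1.
have rN0 : (r != 0)%R by rewrite gt_eqF.
have Gfin : \int[mu]_x (G x)%:E \is a fin_num by rewrite ge0_fin_numE.
set g := fine (\int[mu]_x (G x)%:E).
have gE : \int[mu]_x (G x)%:E = g%:E by rewrite fineK.
have g0 : (0 <= g)%R by rewrite fine_ge0.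
have mFr : measurable_fun setT (fun x => (F x `^ r)%R).
  exact: (measurableT_comp (measurable_powR r)).
have Fr0 x : (0 <= F x `^ r)%R by rewrite powR_ge0.
(* Integrating this pointwise bound gives the integral of [F^r] times [g * g^(r - 1)], which is the
   [r]-th power of the right-hand side. *)
suff H x : econv F G x `^ r <=
    econv (fun x => F x `^ r)%R G x * (g `^ (r - 1))%:E.
  have A0 : 0 <= \int[mu]_x (F x `^ r)%:E.
    by apply: integral_ge0 => x _; rewrite lee_fin.
  rewrite gE unlock /Lnorm.
  have -> : \int[mu]_x (`|(EFin \o F) x| `^ r) = \int[mu]_x (F x `^ r)%:E.
    by apply: eq_integral => x _; rewrite /= ger0_norm.
  have -> : g%:E = (g `^ r)%:E `^ r^-1.
    by rewrite poweR_EFin -powRrM mulfV// powRr1.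
  rewrite -poweRM// ?lee_fin ?powR_ge0//.
  apply: gt0_le_poweR; first by rewrite invr_gt0.
    by apply: integral_ge0 => x _; exact: poweR_ge0.
  have -> : (g `^ r)%:E = g%:E * (g `^ (r - 1))%:E by rewrite -EFinM mulr_powRB1.
  rewrite muleA -gE -integral_econv// -ge0_integralZr//; last 3 first.
  - exact: measurable_econv.
  - by move=> x _; exact: econv_ge0.
  - by rewrite lee_fin powR_ge0.
  apply: ge0_le_integral => //.
  - by move=> x _; exact: poweR_ge0.
  - by apply: measurable_abse_poweR; exact: measurable_econv.
  - by apply: emeasurable_funM => //; exact: measurable_econv.
  - by move=> x _; rewrite gee0_abs ?econv_ge0.
(* For [r = 1] the conjugate exponent is infinite, but the claim is an equality. Otherwise Hölder is
   applied to [F (x - y) * G y ^ (1 / r)] and [G y ^ (1 / r')]. *)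
have [->|rn1] := eqVneq r 1%R.
  rewrite subrr powRr0 mule1 poweRe1 ?econv_ge0//.
  by under eq_fun do rewrite powRr1//.
pose r' := ((1 - r^-1)^-1)%R.
have rV1 : (r^-1 < 1)%R by rewrite invf_lt1// lt_neqAle eq_sym rn1.
have r'0 : (0 < r')%R by rewrite invr_gt0 subr_gt0.
have rr' : (r^-1 + r'^-1 = 1)%R by rewrite invrK addrC subrK.
pose f1 y := (F (x - y) * G y `^ r^-1)%R.
pose g1 y := (G y `^ r'^-1)%R.
have mf1 : measurable_fun setT f1.
  apply: measurable_funM; first exact: (measurableT_comp mF (measurable_subrVl x)).
  exact: (measurableT_comp (measurable_powR _)).
have mg1 : measurable_fun setT g1 by exact: (measurableT_comp (measurable_powR _)).
have := hoelder mu mf1 mg1 r0 r'0 rr'.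
rewrite Lnorm1.
have -> : \int[mu]_y `|(EFin \o (f1 \* g1)%R) y| = econv F G x.
  apply: eq_integral => y _; rewrite /= /f1 /g1 -mulrA -powRD; last by rewrite rr' oner_eq0.
  by rewrite rr' powRr1// ger0_norm// mulr_ge0.
move=> /(gt0_le_poweR r0 (econv_ge0 x F0 G0)) /le_trans; apply.
rewrite poweRM ?Lnorm_ge0// poweR_Lnorm//.
have -> : \int[mu]_y (`|(EFin \o f1) y| `^ r) = econv (fun x => F x `^ r)%R G x.
  apply: eq_integral => y _; rewrite /= ger0_norm; last first.
    by rewrite mulr_ge0 ?powR_ge0.
  by rewrite /f1 powRM ?powR_ge0// -powRrM mulVf// powRr1.
rewrite unlock /Lnorm.
have -> : \int[mu]_y (`|(EFin \o g1) y| `^ r') = g%:E.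
  rewrite -gE; apply: eq_integral => y _; rewrite /= ger0_norm ?powR_ge0//.
  by rewrite /g1 -powRrM mulVf ?gt_eqF// powRr1.
rewrite -poweRrM -poweR_EFin (_ : r'^-1 * r = r - 1)%R //.
by rewrite invrK mulrBl mul1r mulVf.
Qed.

End young.

(** * Algebra of the convolution of complex-valued functions *)

Section convolution_theory.
Variables (R : realType) (n : nat).
Local Notation V := 'rV[R]_n.
Local Notation mu := (lebesgue_rV R n).
Implicit Types (f g h : V -> R[i]) (p : \bar R).

Lemma Lpnorm1 g : Lpnorm 1 g = (\int[mu]_x (normc (g x))%:E)%E.
Proof.
rewrite /Lpnorm Lnorm1; apply: eq_integral => x _.
by rewrite gee0_abs// lee_fin normc_ge0.
Qed.

Lemma mem_Lp1P g : mem_Lp 1 g <-> cintegrable mu g.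
Proof.
split=> [[g1 g2]|[[g1 g2] goo]]; last by split=> //; rewrite Lpnorm1.
by rewrite Lpnorm1; split.
Qed.

Lemma mem_Lp_meas p f : mem_Lp p f -> cmeasurable f.
Proof. by case. Qed.

Lemma Lpnorm_ge0 p f : (0 <= Lpnorm p f)%E.
Proof. exact: Lnorm_ge0. Qed.

Lemma ae_eq_Lpnorm p f g : (1 <= p)%E -> cmeasurable f -> cmeasurable g ->
  {ae mu, forall x, f x = g x} -> Lpnorm p f = Lpnorm p g.
Proof.
move=> p1 mf mg fg; apply: ae_eq_Lnorm => //; [exact: measurable_enormc..|].
by apply: filterS fg => x ->.
Qed.

Lemma Lpnorm_triangle p f g : (1 <= p)%E -> cmeasurable f -> cmeasurable g ->
  (Lpnorm p (fun x => f x + g x)%R <= Lpnorm p f + Lpnorm p g)%E.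
Proof.
move=> p1 mf mg; rewrite /Lpnorm.
have := eminkowski mu (measurable_normc mf) (measurable_normc mg) p1.
apply: le_trans; apply: le_Lnorm => //.
- by apply: measurable_enormc; exact: cmeasurableD.
- by apply/measurable_EFinP; apply: measurable_funD; exact: measurable_normc.
- move=> x /=; rewrite lee_fin !ger0_norm ?addr_ge0 ?normc_ge0//.
  exact: le_normcD.
Qed.

Lemma LpnormN p f : Lpnorm p (fun x => - f x) = Lpnorm p f.
Proof. by apply: eq_Lnorm => x; rewrite normcN. Qed.

Lemma mem_LpB p f g : (1 <= p)%E -> mem_Lp p f -> mem_Lp p g ->
  mem_Lp p (fun x => f x - g x).
Proof.
move=> p1 [f1 f2 foo] [g1 g2 goo].
have mf : cmeasurable f by split.
have mg : cmeasurable g by split.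
have [m1 m2] := cmeasurableB mf mg; split => //.
apply: le_lt_trans (Lpnorm_triangle p1 mf (cmeasurableN mg)) _.
by rewrite LpnormN lte_add_pinfty.
Qed.

Lemma cmeasurable_conv_kernel f g : cmeasurable f -> cmeasurable g ->
  cmeasurable (fun z : V * V => f (z.1 - z.2) * g z.2).
Proof.
move=> mf mg; apply: cmeasurableM.
  exact: (cmeasurable_comp (@measurable_subrV R n) mf).
exact: (cmeasurable_comp measurable_snd mg).
Qed.

Lemma cmeasurable_conv_kernel1 f g x : cmeasurable f -> cmeasurable g ->
  cmeasurable (fun y : V => f (x - y) * g y).
Proof.
move=> mf mg; apply: cmeasurableM => //.
exact: (cmeasurable_comp (measurable_subrVl x) mf).
Qed.

Lemma convE f g x : convolution f g x = cint mu (fun y => f (x - y) * g y).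
Proof. by []. Qed.

Lemma cmeasurable_conv f g : cmeasurable f -> cmeasurable g ->
  cmeasurable (convolution f g).
Proof.
move=> mf mg.
exact: (cmeasurable_cint mu (F := fun z : V * V => f (z.1 - z.2) * g z.2)
  (cmeasurable_conv_kernel mf mg)).
Qed.

Local Notation nf f := (fun x => normc (f x)).

Lemma normc_conv_le f g x : cmeasurable f -> cmeasurable g ->
  ((normc (convolution f g x))%:E <= econv (nf f) (nf g) x)%E.
Proof.
move=> mf mg; rewrite convE (le_trans (normc_cint_le _ _))//.
  exact: cmeasurable_conv_kernel1.
by under eq_integral do rewrite ComplexField.Normc.normcM.
Qed.

Lemma Lpnorm_conv_le p f g : (1 <= p)%E -> mem_Lp p f -> mem_Lp 1 g ->
  (Lpnorm p (convolution f g) <= Lpnorm p f * Lpnorm 1 g)%E.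
Proof.
move=> p1 [f1 f2 foo] /mem_Lp1P [mg goo]; have mf : cmeasurable f by split.
rewrite Lpnorm1.
have := young_econv p1 (measurable_normc mf) (measurable_normc mg)
  (fun x => normc_ge0 _) (fun x => normc_ge0 _) foo goo.
apply: le_trans; apply: le_Lnorm => //.
- by apply: measurable_enormc; exact: cmeasurable_conv.
- by apply: measurable_econv => //; try exact: measurable_normc;
    move=> x; exact: normc_ge0.
- move=> x; rewrite gee0_abs ?lee_fin ?normc_ge0//.
  by rewrite gee0_abs ?normc_conv_le// econv_ge0// => y; exact: normc_ge0.
Qed.

Lemma mem_Lp_conv p f g : (1 <= p)%E -> mem_Lp p f -> mem_Lp 1 g ->
  mem_Lp p (convolution f g).
Proof.
move=> p1 fp g1; have := Lpnorm_conv_le p1 fp g1.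
case: fp g1 => [f1 f2 foo] [g1 g2 goo].
have [m1 m2] : cmeasurable (convolution f g) by apply: cmeasurable_conv; split.
move=> le; split=> //; apply: le_lt_trans le _.
by rewrite lte_mul_pinfty ?ge0_fin_numE ?Lpnorm_ge0.
Qed.

(** Young's inequality makes the [L^p] norm finite, and a function of finite norm is finite almost
    everywhere. *)
Lemma ae_econv_lty p f (G : V -> R) : (1 <= p)%E -> mem_Lp p f ->
  measurable_fun setT G -> (forall x, 0 <= G x) ->
  (\int[mu]_x (G x)%:E < +oo)%E ->
  {ae mu, forall x, (econv (nf f) G x < +oo)%E}.
Proof.
move=> p1 [f1 f2 foo] mG G0 Goo; have mf : cmeasurable f by split.
have mH : measurable_fun setT (econv (nf f) G).
  apply: measurable_econv => //; first exact: measurable_normc.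
  by move=> x; exact: normc_ge0.
have := young_econv p1 (measurable_normc mf) mG (fun x => normc_ge0 _) G0 foo Goo.
have /lt_le_trans H : (Lpnorm p f * \int[mu]_x (G x)%:E < +oo)%E.
  rewrite lte_mul_pinfty ?ge0_fin_numE ?Lpnorm_ge0//.
move=> /le_lt_trans/(_ (H _ (lexx _))) /(Lnorm_lty_ae p1 mH).
apply: filterS => x; rewrite gee0_abs// econv_ge0// => y; exact: normc_ge0.
Qed.

Lemma ae_conv_integrable p f g : (1 <= p)%E -> mem_Lp p f -> mem_Lp 1 g ->
  {ae mu, forall x, cintegrable mu (fun y => f (x - y) * g y)}.
Proof.
move=> p1 fp /mem_Lp1P [mg goo]; have mf := mem_Lp_meas fp.
have := ae_econv_lty p1 fp (measurable_normc mg) (fun x => normc_ge0 _) goo.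
apply: filterS => x xoo; split; first exact: cmeasurable_conv_kernel1.
by under eq_integral do rewrite ComplexField.Normc.normcM.
Qed.

Lemma cint_reflect f x : cmeasurable f -> cint mu (fun y => f (x - y)) = cint mu f.
Proof.
move=> mf.
rewrite (cint_change (k := 1) (m1 := mu) (m2 := mu) (phi := fun y => x - y) ltr01 _ mf) ?mul1r//.
by move=> F mF F0; rewrite mul1e; exact: ge0_integral_rV_reflect.
Qed.

Lemma cint_translate f y : cmeasurable f -> cint mu (fun x => f (x + y)) = cint mu f.
Proof.
move=> mf.
rewrite (cint_change (k := 1) (m1 := mu) (m2 := mu) (phi := fun x => x + y) ltr01 _ mf) ?mul1r//.
by move=> F mF F0; rewrite mul1e; exact: ge0_integral_rV_translate.
Qed.

(** An equality at every point: the reflection [y |-> x - y] preserves the integral, default value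
    included. *)
Lemma convC f g : cmeasurable f -> cmeasurable g -> convolution f g = convolution g f.
Proof.
move=> mf mg; apply/funext => x; rewrite !convE.
rewrite -(cint_reflect x (cmeasurable_conv_kernel1 x mg mf)).
by apply: eq_cint => y; rewrite subKr mulrC.
Qed.

Lemma ae_eq_convr f g g' : cmeasurable f -> cmeasurable g -> cmeasurable g' ->
  {ae mu, forall x, g x = g' x} -> convolution f g = convolution f g'.
Proof.
move=> mf mg mg' gg'; apply/funext => x; rewrite !convE.
apply: ae_eq_cint; [exact: cmeasurable_conv_kernel1..|].
by apply: filterS gg' => y ->.
Qed.

Lemma ae_eq_convl f f' g : cmeasurable f -> cmeasurable f' -> cmeasurable g ->
  {ae mu, forall x, f x = f' x} -> convolution f g = convolution f' g.
Proof.
by move=> mf mf' mg ff'; rewrite convC// [RHS]convC//; exact: ae_eq_convr.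
Qed.

Lemma ae_convBl p f f' g : (1 <= p)%E -> mem_Lp p f -> mem_Lp p f' -> mem_Lp 1 g ->
  {ae mu, forall x, convolution (fun y => f y - f' y) g x =
    convolution f g x - convolution f' g x}.
Proof.
move=> p1 fp fp' g1.
apply: filterS2 (ae_conv_integrable p1 fp g1) (ae_conv_integrable p1 fp' g1).
move=> x xf xf'; rewrite !convE -cintB//.
by apply: eq_cint => y; rewrite mulrBl.
Qed.

(** Fubini for the kernel [F], whose absolute integrability is the finiteness hypothesis. The
    statement concerns a single point because multiplicativity of the Fourier transform uses it at
    the origin, with [f] a character. *)
Lemma convA_at f g h x : cmeasurable f -> cmeasurable g -> cmeasurable h ->
  (\int[mu]_u ((normc (f (x - u)))%:E * econv (nf g) (nf h) u) < +oo)%E ->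
  convolution (convolution f g) h x = convolution f (convolution g h) x.
Proof.
move=> mf mg mh foo.
pose F (z : V * V) := f (x - z.1) * (g (z.1 - z.2) * h z.2).
have mF : cmeasurable F.
  apply: cmeasurableM; last exact: cmeasurable_conv_kernel.
  apply: (cmeasurable_comp _ mf).
  exact: (measurableT_comp (measurable_subrVl x)).
have iF : cintegrable (mu \x mu)%E F.
  split=> //; rewrite fubini_tonelli1//=.
  - apply: le_lt_trans foo; rewrite le_eqVlt; apply/orP; left; apply/eqP.
    apply: eq_integral => u _; rewrite /fubini_F.
    under eq_integral do rewrite /F /= ComplexField.Normc.normcM EFinM.
    rewrite ge0_integralZl//.
    + by under eq_integral do rewrite ComplexField.Normc.normcM.
    + by apply: measurable_enormc; exact: cmeasurable_conv_kernel1.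
    + by move=> y _; rewrite lee_fin normc_ge0.
    + by rewrite lee_fin normc_ge0.
  - exact: measurable_enormc.
  - by move=> z; rewrite lee_fin normc_ge0.
have E1 : convolution f (convolution g h) x = cint mu (fun u => cint mu (fun y => F (u, y))).
  rewrite convE; apply: ae_eq_cint.
  - by apply: cmeasurable_conv_kernel1 => //; exact: cmeasurable_conv.
  - exact: (cmeasurable_cint mu mF).
  - apply: filterS (ae_cintegrable1 iF) => u ui.
    by rewrite convE -cintZ_weak.
have E2 : convolution (convolution f g) h x =
    cint mu (fun y => cint mu (fun u => F (u, y))).
  rewrite convE; apply: ae_eq_cint.
  - by apply: cmeasurable_conv_kernel1 => //; exact: cmeasurable_conv.
  - apply: (cmeasurable_cint mu (F := fun z : V * V => F (z.2, z.1))).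
    exact: (cmeasurable_comp (@measurable_swap _ _ V V) mF).
  - apply: filterS (ae_cintegrable2 iF) => y yi.
    have E : (fun u => F (u, y)) = (fun u => h y * (f (x - u) * g (u - y))).
      by apply/funext => u; rewrite /F /=; ring.
    rewrite E in yi *; rewrite cintZ_weak// mulrC convE; congr (_ * _).
    rewrite -(cint_translate (- y) (cmeasurable_conv_kernel1 (x - y) mf mg)).
    by apply: eq_cint => u; rewrite opprB addrA subrK.
exact: etrans E2 (etrans (esym (cint_fubini iF)) (esym E1)).
Qed.

Lemma integral_econv_lty g h : mem_Lp 1 g -> mem_Lp 1 h ->
  (\int[mu]_x econv (nf g) (nf h) x < +oo)%E.
Proof.
move=> /mem_Lp1P[mg goo] /mem_Lp1P[mh hoo].
rewrite integral_econv; try exact: measurable_normc.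
- rewrite lte_mul_pinfty//; first by apply: integral_ge0 => x _; rewrite lee_fin normc_ge0.
  by rewrite ge0_fin_numE//; apply: integral_ge0 => x _; rewrite lee_fin normc_ge0.
- by move=> x; exact: normc_ge0.
- by move=> x; exact: normc_ge0.
Qed.

(** The condition of [convA_at] is the finiteness at [x] of the convolution of the modulus of [f]
    with that of the moduli of [g] and [h]. The latter is integrable, hence almost everywhere equal
    to its real-valued version [G], to which Young's inequality applies. *)
Lemma ae_convA p f g h : (1 <= p)%E -> mem_Lp p f -> mem_Lp 1 g -> mem_Lp 1 h ->
  {ae mu, forall x,
    convolution (convolution f g) h x = convolution f (convolution g h) x}.
Proof.
move=> p1 fp g1 h1.
have mf := mem_Lp_meas fp; have mg := mem_Lp_meas g1; have mh := mem_Lp_meas h1.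
have n0 (k : V -> R[i]) (x : V) : 0 <= normc (k x) by exact: normc_ge0.
have ghoo := integral_econv_lty g1 h1.
have gh0 u : (0 <= econv (nf g) (nf h) u)%E by exact: econv_ge0.
have mgh : measurable_fun setT (econv (nf g) (nf h)).
  by apply: measurable_econv => //; exact: measurable_normc.
have igh : mu.-integrable setT (econv (nf g) (nf h)).
  apply/integrableP; split => //.
  by under eq_integral do rewrite gee0_abs//.
pose G u := fine (econv (nf g) (nf h) u).
have mG : measurable_fun setT G by exact: measurableT_comp.
have G0 u : 0 <= G u by rewrite fine_ge0.
have GE : {ae mu, forall u, (G u)%:E = econv (nf g) (nf h) u}.
  apply: filterS (integrable_ae measurableT igh) => u /(_ I) ufin.
  by rewrite fineK.
have Goo : (\int[mu]_u (G u)%:E < +oo)%E.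
  rewrite (ge0_ae_eq_integral _ _ mgh)//; first exact/measurable_EFinP.
    by move=> u _; rewrite lee_fin.
  by apply: filterS GE => u -> .
apply: filterS (ae_econv_lty p1 fp mG G0 Goo) => x xoo.
apply: convA_at => //; apply: le_lt_trans xoo.
rewrite le_eqVlt; apply/orP; left; apply/eqP; apply: ge0_ae_eq_integral => //.
- apply: emeasurable_funM => //; apply/measurable_enormc.
  exact: (cmeasurable_comp (measurable_subrVl x) mf).
- apply/measurable_EFinP.
  exact: (measurable_conv_kernel1 x (measurable_normc mf) mG).
- by move=> u _; rewrite mule_ge0// lee_fin.
- by move=> u _; rewrite lee_fin mulr_ge0.
- by apply: filterS GE => u uE _; rewrite EFinM uE.
Qed.

End convolution_theory.

(** * Continuity of translations in L^1 *)

Section translation_continuity.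
Variables (R : realType) (n : nat).
Local Notation V := 'rV[R]_n.
Local Notation mu := (lebesgue_rV R n).
Implicit Types (g : V -> R) (h x : V) (A B : set V).
Local Open Scope ereal_scope.

Definition L1shift g h : \bar R := \int[mu]_x `|g (x + h) - g x|%:E.

(** The size of the shift is measured coordinate by coordinate, which suits boxes. *)
Definition L1cont g := measurable_fun setT g /\
  forall e : R, (0 < e)%R -> exists2 d : R, (0 < d)%R &
    forall h, (forall i, `|h ord0 i| <= d)%R -> L1shift g h <= e%:E.

Let measurable_shift g h : measurable_fun setT g ->
  measurable_fun setT (fun x => g (x + h)%R).
Proof. by move=> mg; exact: (measurableT_comp mg (measurable_addrVr h)). Qed.

Let measurable_diff g h : measurable_fun setT g ->
  measurable_fun setT (fun x => `|g (x + h) - g x|%:E).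
Proof.
move=> mg; apply/measurable_EFinP; apply: measurableT_comp => //.
by apply: measurable_funB => //; exact: measurable_shift.
Qed.

(** One estimate serves for sums of functions and, through indicators, for intersections and
    differences of sets. *)
Lemma L1cont_dom2 g g1 g2 : measurable_fun setT g -> L1cont g1 -> L1cont g2 ->
  (forall x y, `|g x - g y| <= `|g1 x - g1 y| + `|g2 x - g2 y|)%R -> L1cont g.
Proof.
move=> mg [mg1 g1c] [mg2 g2c] gle; split=> // e e0.
have e2 : (0 < e / 2)%R by rewrite divr_gt0.
have [d1 d10 H1] := g1c _ e2; have [d2 d20 H2] := g2c _ e2.
exists (Num.min d1 d2) => [|h hd]; first by rewrite lt_min d10.
apply: (@le_trans _ _ (L1shift g1 h + L1shift g2 h)).
  rewrite /L1shift -ge0_integralD//; [|exact: measurable_diff..].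
  apply: ge0_le_integral => //.
  - exact: measurable_diff.
  - by apply: emeasurable_funD; exact: measurable_diff.
  - by move=> x _; rewrite -EFinD lee_fin.
rewrite [e]splitr EFinD; apply: leeD.
  by apply: H1 => i; rewrite (le_trans (hd i))// ge_min lexx.
by apply: H2 => i; rewrite (le_trans (hd i))// ge_min lexx orbT.
Qed.

Lemma L1contZ (c : R) g : L1cont g -> L1cont (fun x => c * g x)%R.
Proof.
move=> [mg gc]; split; first exact: measurable_funM.
move=> e e0; have c1 : (0 < `|c| + 1)%R by rewrite ltr_wpDl.
have [d d0 H] := gc (e / (`|c| + 1))%R (divr_gt0 e0 c1).
exists d => // h hd; have := H _ hd; rewrite /L1shift => H'.
have -> : \int[mu]_x `|c * g (x + h) - c * g x|%:E = `|c|%:E * \int[mu]_x `|g (x + h) - g x|%:E.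
  rewrite -ge0_integralZl//; last exact: measurable_diff.
  by apply: eq_integral => x _; rewrite -mulrBr normrM EFinM.
apply: (@le_trans _ _ (`|c|%:E * (e / (`|c| + 1))%:E)).
  by rewrite lee_wpmul2l.
rewrite -EFinM lee_fin mulrA ler_pdivrMr// mulrC ler_wpM2l ?lerDl//; exact: ltW.
Qed.

Lemma L1cont0 : L1cont (fun=> 0%R).
Proof.
split=> // e e0; exists 1%R => // h _.
by rewrite /L1shift; under eq_integral do rewrite subrr normr0; rewrite integral0 lee_fin ltW.
Qed.

Lemma L1contD g1 g2 : L1cont g1 -> L1cont g2 -> L1cont (fun x => g1 x + g2 x)%R.
Proof.
move=> c1 c2; apply: (L1cont_dom2 _ c1 c2).
  by case: c1 c2 => [m1 _] [m2 _]; exact: measurable_funD.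
move=> x y; rewrite (_ : _ - _ = (g1 x - g1 y) + (g2 x - g2 y))%R; last by ring.
exact: ler_normD.
Qed.

(** Three-epsilon argument, in which translation invariance makes the two approximation errors
    equal. *)
Lemma L1cont_closed g : measurable_fun setT g ->
  (forall e : R, (0 < e)%R -> exists2 g', L1cont g' &
     \int[mu]_x `|g x - g' x|%:E <= e%:E) -> L1cont g.
Proof.
move=> mg H; split=> // e e0.
have e3 : (0 < e / 3)%R by rewrite divr_gt0.
have [g' [mg' g'c] gg'] := H _ e3; have [d d0 Hd] := g'c _ e3.
exists d => // h hd.
have mD : measurable_fun setT (fun x => `|g x - g' x|%:E).
  apply/measurable_EFinP; apply: measurableT_comp => //.
  exact: measurable_funB.
have mDh : measurable_fun setT (fun x => `|g (x + h)%R - g' (x + h)%R|%:E).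
  exact: (measurableT_comp mD (measurable_addrVr h)).
have mm := measurable_diff h mg'.
apply: (@le_trans _ _ (\int[mu]_x `|g (x + h)%R - g' (x + h)%R|%:E +
    (L1shift g' h + \int[mu]_x `|g x - g' x|%:E))).
  rewrite /L1shift -(ge0_integralD _ _ _ mm)// -ge0_integralD//; last first.
  - exact: emeasurable_funD.
  - by move=> x _; exact: adde_ge0.
  apply: ge0_le_integral => //.
  - exact: measurable_diff.
  - by apply: emeasurable_funD => //; exact: emeasurable_funD.
  - move=> x _; rewrite -!EFinD lee_fin.
    have -> : (g (x + h) - g x = (g (x + h) - g' (x + h)) +
      ((g' (x + h) - g' x) - (g x - g' x)))%R by ring.
    rewrite (le_trans (ler_normD _ _))// lerD2l.
    exact: ler_normB.
apply: (@le_trans _ _ ((e / 3)%:E + ((e / 3)%:E + (e / 3)%:E))); last first.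
  by rewrite -!EFinD lee_fin; lra.
apply: leeD; last by apply: leeD => //; exact: Hd.
apply: le_trans gg'; rewrite le_eqVlt; apply/orP; left; apply/eqP.
by apply: (ge0_integral_rV_translate h (F := fun x => `|g x - g' x|%:E)).
Qed.

Definition boxoc (a b : V) : set V :=
  [set x | forall i, `]a ord0 i, b ord0 i]%classic (x ord0 i)].

Lemma measurable_box (A : 'I_n -> set R) : (forall i, measurable (A i)) ->
  measurable [set x : V | forall i, A i (x ord0 i)].
Proof.
move=> mA.
rewrite [X in measurable X](_ : _ =
    \bigcap_i ((fun x : V => x ord0 i) @^-1` A i)).
  apply: fin_bigcap_measurable => // i _.
  by rewrite -[X in measurable X]setTI; exact: measurable_coord.
by apply/seteqP; split => x /= Ax i; [move=> _; exact: Ax|exact: Ax].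
Qed.

Lemma measurable_boxoc (a b : V) : measurable (boxoc a b).
Proof.
by apply: (@measurable_box (fun i => `]a ord0 i, b ord0 i]%classic)) => i; exact: measurable_itv.
Qed.

Lemma lebesgue_rV_boxoc (a b : V) : (forall i, a ord0 i < b ord0 i)%R ->
  mu (boxoc a b) = (\prod_(i < n) (b ord0 i - a ord0 i))%:E.
Proof.
move=> ab; apply: etrans.
  apply: (@lebesgue_rV_box R n (fun i => `]a ord0 i, b ord0 i]%classic)) => i.
  exact: measurable_itv.
rewrite -prodEFin; apply: eq_bigr => i _.
by rewrite lebesgue_measure_itv/= lte_fin ab.
Qed.

(** Let [B'] be the box shrunk by [d] on every side. If all [|h_i| <= d] and [x] or [x + h] is in
    [B'], both points are in the box; so the indicator can change only if [x] or [x + h] lies in the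
    box outside [B'], a set of small measure. *)
Lemma L1cont_boxoc (a b : V) : L1cont \1_(boxoc a b).
Proof.
have [ab|/existsNP[i /negP]] := pselect (forall i, a ord0 i < b ord0 i)%R; last first.
  rewrite -leNgt => ba; rewrite (_ : boxoc a b = set0).
    by rewrite indic0; exact: L1cont0.
  apply/seteqP; split=> // x /(_ i); rewrite /= in_itv/= => /andP[ax xb].
  by have := lt_le_trans ax (le_trans xb ba); rewrite ltxx.
split; first exact: measurable_indic (measurable_boxoc a b).
move=> e e0.
(* [p.[d]] is the volume of the shrunken box; a polynomial in [d], it tends to [p.[0]]. The number
   [d] is also taken small enough for the shrunken box to be nondegenerate, as the volume formula
   requires. *)
pose p : {poly R} := (\prod_(i < n) ((b ord0 i - a ord0 i)%:P - 2%:P * 'X))%R.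
have pE d : (p.[d] = \prod_(i < n) (b ord0 i - a ord0 i - 2 * d))%R.
  by rewrite horner_prod; apply: eq_bigr => i _; rewrite !hornerE.
have p0 : (p.[0] = \prod_(i < n) (b ord0 i - a ord0 i))%R.
  by rewrite pE; apply: eq_bigr => i _; rewrite mulr0 subr0.
have [d d0 [pd abd]] : exists2 d : R, (0 < d)%R &
    (p.[0] - p.[d] <= e / 2)%R /\ (forall i, a ord0 i + d < b ord0 i - d)%R.
  have c1 : (p.[x])%R @[x --> (0:R)^'+] --> (p.[0])%R.
    by apply: cvg_at_right_filter; exact: continuous_horner.
  have e2 : (0 < e / 2)%R by rewrite divr_gt0.
  have n1 : \forall d \near (0:R)^'+, (p.[0] - p.[d] <= e / 2)%R.
    near=> d; apply: le_trans (ler_norm _) _; near: d.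
    by move/cvgrPdist_le : c1 => /(_ _ e2).
  have n2 : \forall d \near (0:R)^'+, forall i, (a ord0 i + d < b ord0 i - d)%R.
    apply: filter_forall => i; near=> d.
    have : (d < (b ord0 i - a ord0 i) / 2)%R.
      by near: d; apply: nbhs_right_lt; rewrite divr_gt0// subr_gt0.
    lra.
  have [d [[d1 d2] d3]] := filter_ex (filterI (filterI n1 n2) (nbhs_right_gt (0:R))).
  by exists d.
pose B' := boxoc (\row_i (a ord0 i + d))%R (\row_i (b ord0 i - d))%R.
have mB := measurable_boxoc a b.
have mB' : measurable B' by exact: measurable_boxoc.
have B'B : B' `<=` boxoc a b.
  move=> x Bx i; have := Bx i; rewrite /= !mxE !in_itv/=; lra.
have muD : mu (boxoc a b `\` B') <= (e / 2)%:E.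
  have muB : mu (boxoc a b) < +oo by rewrite lebesgue_rV_boxoc// ltry.
  have -> : mu (boxoc a b `\` B') = mu (boxoc a b) - mu B'.
    by apply: etrans (measureD mB mB' muB) _; congr (_ - mu _); rewrite setIidr.
  rewrite !lebesgue_rV_boxoc//; last by move=> i; rewrite !mxE.
  rewrite -EFinB lee_fin -p0 (_ : \prod_(i < n) _ = p.[d])%R//.
  by rewrite pE; apply: eq_bigr => i _; rewrite !mxE; ring.
exists d => // h hd; rewrite /L1shift.
pose D : V -> R := \1_(boxoc a b `\` B').
have mD : measurable_fun setT (fun x => (D x)%:E).
  by apply/measurable_EFinP; apply: measurable_indic; exact: measurableD.
have mDh : measurable_fun setT (fun x => (D (x + h)%R)%:E).
  exact: (measurableT_comp mD (measurable_addrVr h)).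
apply: (@le_trans _ _ (\int[mu]_x ((D x)%:E +
   (D (x + h)%R)%:E))).
  apply: ge0_le_integral => //.
  - by apply: measurable_diff; exact: measurable_indic.
  - exact: emeasurable_funD.
  move=> x _; rewrite -EFinD lee_fin.
  have hi i : (- d <= h ord0 i <= d)%R by rewrite -ler_norml.
  have S1 : B' x -> boxoc a b (x + h)%R.
    move=> Bx i; have := Bx i; have := hi i; rewrite /= !mxE !in_itv/=; lra.
  have S2 : B' (x + h)%R -> boxoc a b x.
    move=> Bx i; have := Bx i; have := hi i; rewrite /= !mxE !in_itv/=; lra.
  rewrite /D !indicE !in_setD.
  have := @B'B x; have := @B'B (x + h)%R.
  have [x1|x1] := boolP (x \in boxoc a b); have [x2|x2] := boolP ((x + h)%R \in boxoc a b);
    rewrite /= ?subrr ?normr0 ?addr_ge0 ?sub0r ?subr0 ?normrN ?normr1//.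
    have -> : (x \notin B') by apply/negP => /set_mem/S1/mem_set; rewrite (negbTE x2).
    by rewrite ?lerDl// ?lerDr.
  have -> : ((x + h)%R \notin B') by apply/negP => /set_mem/S2/mem_set; rewrite (negbTE x1).
  by rewrite ?lerDl// ?lerDr.
have D0 x : 0 <= (D x)%:E by rewrite lee_fin /D indicE.
rewrite (ge0_integralD _ measurableT (fun x _ => D0 x) mD (fun x _ => D0 _) mDh).
rewrite (ge0_integral_rV_translate h (F := fun x => (D x)%:E))//.
rewrite /D integral_indic ?setIT//; last exact: measurableD.
by rewrite [e]splitr EFinD; exact: leeD.
Unshelve. all: by end_near. Qed.

End translation_continuity.

(** * From boxes to all integrable functions *)

Section translation_continuity_L1.
Variables (R : realType) (n : nat).
Local Notation V := 'rV[R]_n.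
Local Notation mu := (lebesgue_rV R n).
Implicit Types (g : V -> R) (h x : V) (A B : set V).
Local Open Scope ereal_scope.

Lemma ecvg0_le (u : nat -> \bar R) (e : R) : (0 < e)%R -> u @ \oo --> 0%E ->
  exists N, u N <= e%:E.
Proof.
move=> e0 /fine_cvgP[[N1 _ ufin] /cvgrPdist_le/(_ _ e0)[N2 _ H]].
exists (maxn N1 N2).
rewrite -(fineK (ufin _ _)) /= ?leq_maxl// lee_fin.
apply: le_trans (ler_norm _) _; rewrite -normrN -[(- _)%R]add0r.
by apply: H; rewrite /= leq_maxr.
Qed.

(** The parts of the union not yet covered decrease to the empty set and have finite measure, so the
    indicators converge in [L^1]. *)
Lemma L1cont_nd (G : nat -> set V) : (forall N, measurable (G N)) ->
  nondecreasing_seq G -> mu (\bigcup_N G N) < +oo ->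
  (forall N, L1cont (\1_(G N) : V -> R)) -> L1cont (\1_(\bigcup_N G N) : V -> R).
Proof.
move=> mG ndG foo cG.
have mU : measurable (\bigcup_N G N) by exact: bigcupT_measurable.
apply: L1cont_closed; first exact: measurable_indic.
move=> e e0; pose F N := (\bigcup_N G N) `\` G N.
have mF N : measurable (F N) by exact: measurableD.
have F0 : mu \o F @ \oo --> 0.
  rewrite -(measure0 mu) (_ : set0 = \bigcap_N F N).
    apply: nonincreasing_cvg_mu => //.
    - rewrite (le_lt_trans _ foo)// le_measure ?inE//.
      exact: subDsetl.
    - exact: bigcapT_measurable.
    - move=> a b ab; apply/subsetPset; apply: setDS; apply/subsetPset; exact: ndG.
  apply/seteqP; split=> // x Fx.
  by have [[N _ GN] _] := Fx 0%N I; have [_] := Fx N I; apply.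
have [N FN] := ecvg0_le e0 F0.
exists \1_(G N) => //; apply: le_trans FN.
rewrite /= -[X in _ <= mu X]setIT -integral_indic// le_eqVlt; apply/orP; left; apply/eqP.
apply: eq_integral => x _; congr EFin.
rewrite !indicE /F in_setD.
have [xU|xU] := boolP (x \in \bigcup_N G N); have [xN|xN] := boolP (x \in G N);
  rewrite /= ?subrr ?subr0 ?normr0 ?normr1//.
move: xU => /negP; case; apply/mem_set; exists N => //; exact: set_mem.
Qed.

Definition cube (k : nat) : set V := boxoc (const_mx (- k.+1%:R)%R) (const_mx k.+1%:R).

Lemma measurable_cube k : measurable (cube k).
Proof. exact: measurable_boxoc. Qed.

Lemma cube_lty k : mu (cube k) < +oo.
Proof.
by rewrite lebesgue_rV_boxoc ?ltry// => i; rewrite !mxE -subr_gt0 opprK addr_gt0.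
Qed.

Lemma nondecreasing_cube : nondecreasing_seq cube.
Proof.
move=> a b ab; apply/subsetPset => x xa i; have := xa i.
have : (a.+1%:R <= b.+1%:R :> R)%R by rewrite ler_nat.
rewrite /= !mxE !in_itv/=; lra.
Qed.

Lemma bigcup_cube : \bigcup_k cube k = setT.
Proof.
apply/seteqP; split=> // x _.
pose M := (\sum_i `|x ord0 i|)%R.
have M0 : (0 <= M)%R by exact: sumr_ge0.
exists (Num.truncn M) => // i; rewrite /= !mxE in_itv/=.
have xM : (`|x ord0 i| <= M)%R.
  by rewrite /M (bigD1 i)//= lerDl sumr_ge0.
have := truncnS_gt M; have := ler_norm (x ord0 i); have := ler_norm (- x ord0 i)%R.
rewrite normrN; lra.
Qed.

Lemma L1cont_indicI A B : L1cont (\1_A : V -> R) -> L1cont (\1_B : V -> R) ->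
  L1cont (\1_(A `&` B) : V -> R).
Proof.
move=> cA cB; apply: (L1cont_dom2 _ cA cB).
  rewrite (_ : \1_(A `&` B) = (fun x => \1_A x * \1_B x)%R :> (V -> R)).
    by case: cA cB => [? _] [? _]; exact: measurable_funM.
  by apply/funext => x; rewrite !indicE in_setI; case: (x \in A); case: (x \in B);
    rewrite /= ?mulr0 ?mul0r ?mulr1.
move=> x y; rewrite !indicE !in_setI; case: (x \in A); case: (x \in B);
  case: (y \in A); case: (y \in B);
  by rewrite /= ?subrr ?normr0 ?subr0 ?sub0r ?normrN ?normr1 ?addr0 ?add0r ?lerDl ?addr_ge0 ?ler01.
Qed.

Lemma L1cont_indicD A B : L1cont (\1_A : V -> R) -> L1cont (\1_B : V -> R) ->
  measurable A -> measurable B ->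
  L1cont (\1_(B `\` A) : V -> R).
Proof.
move=> cA cB mA mB; apply: (L1cont_dom2 _ cA cB).
  by apply: measurable_indic; exact: measurableD.
move=> x y; rewrite !indicE !in_setD; case: (x \in A); case: (x \in B);
  case: (y \in A); case: (y \in B);
  by rewrite /= ?subrr ?normr0 ?subr0 ?sub0r ?normrN ?normr1 ?addr0 ?add0r ?lerDl ?addr_ge0 ?ler01.
Qed.

Lemma L1cont_cube k : L1cont (\1_(cube k) : V -> R).
Proof. exact: L1cont_boxoc. Qed.

(* The [good k] sets contain the slabs, which generate the Borel sets, and form a
   sigma-algebra. *)
Let good k A := measurable A /\ L1cont (\1_(A `&` cube k) : V -> R).

Let good_setD k A : good k A -> good k (setT `\` A).
Proof.
move=> [mA cA]; split; first exact: measurableD.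
rewrite (_ : _ `&` _ = cube k `\` (A `&` cube k)).
  apply: L1cont_indicD => //; first exact: L1cont_cube.
  - by apply: measurableI => //; exact: measurable_cube.
  - exact: measurable_cube.
by apply/seteqP; split=> x /=; tauto.
Qed.

Let good_setI k A B : good k A -> good k B -> good k (A `&` B).
Proof.
move=> [mA cA] [mB cB]; split; first exact: measurableI.
by rewrite -(setIid (cube k)) setIACA; exact: L1cont_indicI.
Qed.

Let good_setU k A B : good k A -> good k B -> good k (A `|` B).
Proof.
move=> gA gB; have := good_setD (good_setI (good_setD gA) (good_setD gB)).
by rewrite !setTD setCI !setCK.
Qed.

Let good_set0 k : good k set0.
Proof. by split=> //; rewrite set0I indic0; exact: L1cont0. Qed.

Let good_bigcup k (F : nat -> set V) : (forall i, good k (F i)) ->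
  good k (\bigcup_i F i).
Proof.
move=> gF; split; first by apply: bigcupT_measurable => i; case: (gF i).
pose U N := \big[setU/set0]_(i < N) F i `&` cube k.
have gU N : good k (\big[setU/set0]_(i < N) F i).
  by elim/big_ind : _ => //; [exact: good_setU].
have UE : \bigcup_i F i `&` cube k = \bigcup_N U N.
  rewrite /U -setI_bigcupl; congr (_ `&` _).
  apply/seteqP; split => x [i _].
    by move=> Fx; exists i.+1 => //; rewrite big_ord_recr/=; right.
  by rewrite -bigcup_mkord => -[j _ Fx]; exists j.
rewrite UE; apply: L1cont_nd.
- move=> N; apply: measurableI; last exact: measurable_cube.
  by case: (gU N).
- apply/nondecreasing_seqP => N; apply/subsetPset; apply: setSI.
  by rewrite big_ord_recr/=; exact: subsetUl.
- rewrite -UE (le_lt_trans _ (cube_lty k))// le_measure ?inE//.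
  + apply: measurableI; last exact: measurable_cube.
    by apply: bigcupT_measurable => i; case: (gF i).
  + exact: measurable_cube.
- by move=> N; case: (gU N).
Qed.

(** This is the reason for cutting with a cube: a slab may have infinite measure, but its trace on
    the cube is a box. *)
Let good_slab k (i : 'I_n) (a b : R) : good k ((fun x : V => x ord0 i) @^-1` `]a, b]).
Proof.
split.
  by rewrite -[X in measurable X]setTI; apply: measurable_coord => //;
    exact: measurable_itv.
rewrite (_ : _ `&` _ = boxoc
    (\row_j if j == i then Num.max a (- k.+1%:R)%R else (- k.+1%:R)%R)
    (\row_j if j == i then Num.min b (k.+1%:R)%R else (k.+1%:R)%R)).
  exact: L1cont_boxoc.
apply/seteqP; split => x /=.
  move=> [xi xk] j; have := xk j; rewrite /= !mxE; case: eqP => // ->.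
  by move: xi; rewrite !in_itv/= gt_max le_min => /andP[-> ->] /andP[-> ->].
move=> H; split.
  by have := H i; rewrite /= !mxE eqxx !in_itv/= gt_max le_min => /andP[/andP[-> _] /andP[-> _]].
move=> j; have := H j; rewrite /= !mxE; case: eqP => // ->.
by rewrite !in_itv/= gt_max le_min => /andP[/andP[_ ->] /andP[_ ->]].
Qed.

Let good_coord k (i : 'I_n) (Y : set R) : measurable Y ->
  good k ((fun x : V => x ord0 i) @^-1` Y).
Proof.
move: Y; pose P (Y : set R) := good k ((fun x : V => x ord0 i) @^-1` Y).
(* The measurable sets of reals are by definition generated by half-open intervals, so this
   reduction is a conversion. *)
suff : <<s @ocitv R >> `<=` P by [].
apply: smallest_sub; last by move=> _ [[a b] _ <-]; exact: good_slab.
split; rewrite /P.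
- by rewrite preimage_set0; exact: good_set0.
- by move=> A /good_setD; rewrite !setTD -preimage_setC.
- by move=> F gF; rewrite preimage_bigcup; exact: good_bigcup.
Qed.

Lemma L1cont_indic_cube k A : measurable A -> L1cont (\1_(A `&` cube k) : V -> R).
Proof.
suff : g_sigma_preimage (fun (i : 'I_n) (x : V) => x ord0 i) `<=` good k.
  by move=> H mA; have [] := H A mA.
apply: smallest_sub.
  split; [exact: good_set0|exact: good_setD|exact: good_bigcup].
rewrite big_seq; elim/big_ind : _ => [B []|X Y XP YP B [/XP|/YP]//|i _ B].
by move=> [Y mY <-]; rewrite setTI; exact: good_coord.
Qed.

Lemma L1cont_indic A : measurable A -> mu A < +oo -> L1cont (\1_A : V -> R).
Proof.
move=> mA Aoo; rewrite -[A]setIT -bigcup_cube setI_bigcupr.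
apply: L1cont_nd.
- by move=> N; apply: measurableI => //; exact: measurable_cube.
- by move=> a b ab; apply/subsetPset; apply: setIS; apply/subsetPset; exact: nondecreasing_cube.
- by rewrite -setI_bigcupr bigcup_cube setIT.
- by move=> N; exact: L1cont_indic_cube.
Qed.

Import HBSimple.

Lemma L1cont_sfun (f : {sfun V >-> R}) : mu.-integrable setT (EFin \o f) -> L1cont f.
Proof.
move=> fi.
rewrite (_ : (f : V -> R) = (fun x =>
    \sum_(y \in range f) (y * \1_(f @^-1` [set y]) x)%R)%R); last first.
  by apply/funext => x; exact: fimfunE.
under eq_fun do rewrite fsbig_finite//=.
elim: (finmap.enum_fset _) => [|y s IH].
  by under eq_fun do rewrite big_nil; exact: L1cont0.
under eq_fun do rewrite big_cons; apply: L1contD => //.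
(* The level set of the value 0 may have infinite measure, but its term is zero. The level set of
   any other [y] has finite measure by Markov's inequality. *)
have [->|y0] := eqVneq y 0%R.
  by under eq_fun do rewrite mul0r; exact: L1cont0.
apply: L1contZ; apply: L1cont_indic => //.
have my : measurable (f @^-1` [set y]) by exact: measurable_sfunP.
have yp : 0 < `|y|%:E by rewrite lte_fin normr_gt0.
suff : `|y|%:E * mu (f @^-1` [set y]) < +oo.
  have [//|] := ltP (mu (f @^-1` [set y])) +oo.
  by rewrite leye_eq => /eqP ->; rewrite gt0_muley.
move/integrableP : fi => [mf]; apply: le_lt_trans.
have mI : measurable_fun setT (fun x => (\1_(f @^-1` [set y]) x : R)%:E).
  by apply/measurable_EFinP; exact: measurable_indic.
have I0 x : 0 <= (\1_(f @^-1` [set y]) x : R)%:E by rewrite lee_fin indicE.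
rewrite -[X in mu X]setIT -integral_indic//.
rewrite -(ge0_integralZl _ measurableT mI (fun x _ => I0 x) (ltW yp)).
apply: ge0_le_integral => //.
- exact: measurable_funeM.
- exact: measurableT_comp.
- move=> x _; rewrite -EFinM lee_fin indicE.
  by have [/set_mem /= ->|_] := boolP (x \in _); rewrite ?mulr1// mulr0.
Qed.

Lemma L1cont_integrable g : mu.-integrable setT (EFin \o g) -> L1cont g.
Proof.
move=> gi; apply: L1cont_closed.
  by case/integrableP : gi => mg _; exact/measurable_EFinP.
move=> e e0; have [g_ [ig_ _ cg]] := approximation_sfun_integrable measurableT gi.
have [N HN] := ecvg0_le e0 cg.
by exists (g_ N) => //; exact: L1cont_sfun.
Qed.

End translation_continuity_L1.

(** * Dilations and approximate identities *)

Section dilation.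
Variables (R : realType) (n : nat).
Local Notation V := 'rV[R]_n.
Local Notation mu := (lebesgue_rV R n).
Implicit Types (f g : V -> R[i]) (e d : R).

Lemma measurable_scalerV e : measurable_fun setT (fun x : V => e *: x).
Proof.
by have := measurable_fun_affine_rV e (0 : V); congr measurable_fun;
  apply/funext => y; rewrite addr0.
Qed.

Lemma ge0_integral_rV_scale e (F : V -> \bar R) : 0 < e ->
  measurable_fun setT F -> (forall x, 0 <= F x)%E ->
  (\int[mu]_x F (e *: x)%R = (e ^- n)%:E * \int[mu]_x F x)%E.
Proof.
move=> e0 mF F0.
have := @ge0_integral_lebesgue_rV_affine _ n e 0 F; rewrite gt_eqF//.
move=> /(_ isT mF F0); rewrite gtr0_norm// => <-.
by apply: eq_integral => y _; rewrite addr0.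
Qed.

Lemma cmeasurable_dilate e g : cmeasurable g -> cmeasurable (dilate e g).
Proof.
move=> mg; apply: cmeasurableM; first exact: cmeasurable_cst.
exact: (cmeasurable_comp (measurable_scalerV e^-1) mg).
Qed.

Lemma cint_scale e g : 0 < e -> cmeasurable g ->
  cint mu (fun x => g (e *: x)) = real_complex R (e ^- n) * cint mu g.
Proof.
move=> e0 mg.
have en : 0 < e ^- n by rewrite invr_gt0 exprn_gt0.
apply: (cint_change (k := e ^- n) (m1 := mu) (m2 := mu) (phi := fun x => e *: x)) => //.
by move=> F mF F0; exact: ge0_integral_rV_scale.
Qed.

Lemma cint_dilate e g : 0 < e -> cmeasurable g -> cint mu (dilate e g) = cint mu g.
Proof.
move=> e0 mg.
have en : 0 < e ^- n by rewrite invr_gt0 exprn_gt0.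
rewrite cint_realZ//; last exact: (cmeasurable_comp (measurable_scalerV e^-1) mg).
rewrite cint_scale ?invr_gt0// mulrA -rmorphM/= exprVn invrK mulVf ?mul1r//.
by rewrite expf_neq0 ?gt_eqF.
Qed.

Lemma Lpnorm1_dilate e g : 0 < e -> cmeasurable g ->
  Lpnorm 1 (dilate e g) = Lpnorm 1 g.
Proof.
move=> e0 mg; rewrite !Lpnorm1.
have en : 0 < e ^- n by rewrite invr_gt0 exprn_gt0.
under eq_integral do rewrite ComplexField.Normc.normcM normc_real gtr0_norm// EFinM.
rewrite ge0_integralZl//; last 3 first.
- apply: measurable_enormc.
  exact: (cmeasurable_comp (measurable_scalerV e^-1) mg).
- by move=> x _; rewrite lee_fin normc_ge0.
- by rewrite lee_fin ltW.
rewrite (@ge0_integral_rV_scale e^-1 (fun x => (normc (g x))%:E)) ?invr_gt0//.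
- rewrite muleA -EFinM exprVn invrK mulVf ?mul1e//.
  by rewrite expf_neq0 ?gt_eqF.
- exact: measurable_enormc.
- by move=> x; rewrite lee_fin normc_ge0.
Qed.

Lemma mem_Lp1_dilate e g : 0 < e -> mem_Lp 1 g -> mem_Lp 1 (dilate e g).
Proof.
move=> e0 g1; have mg := mem_Lp_meas g1.
have [m1 m2] := cmeasurable_dilate e mg; split=> //.
by rewrite Lpnorm1_dilate//; case: g1.
Qed.

Lemma dilateM e d g : dilate e (dilate d g) = dilate (e * d) g.
Proof.
apply/funext => x; rewrite /dilate mulrA -rmorphM/= scalerA.
by rewrite exprMn -!invfM [d * e]mulrC.
Qed.

(** Moves the dilation from the kernel to the shift of [f], where continuity of translations can
    act. *)
Lemma convr_dilateE d f g x : 0 < d -> cmeasurable f -> cmeasurable g ->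
  convolution f (dilate d g) x = cint mu (fun z => f (x - d *: z) * g z).
Proof.
move=> d0 mf mg.
have mH : cmeasurable (fun z : V => f (x - d *: z) * g z).
  apply: cmeasurableM => //; apply: (cmeasurable_comp _ mf).
  exact: (measurableT_comp (measurable_subrVl x) (measurable_scalerV d)).
rewrite -(cint_dilate d0 mH) convE; apply: eq_cint => y.
by rewrite /dilate /= scalerA mulfV ?gt_eqF// scale1r mulrCA.
Qed.

Lemma conv_dilate e f g : 0 < e -> cmeasurable f -> cmeasurable g ->
  convolution (dilate e f) (dilate e g) = dilate e (convolution f g).
Proof.
move=> e0 mf mg; apply/funext => x.
rewrite convr_dilateE//; last exact: cmeasurable_dilate.
have en : 0 < e ^- n by rewrite invr_gt0 exprn_gt0.
rewrite /dilate convE -cint_realZ//; last exact: cmeasurable_conv_kernel1.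
apply: eq_cint => y; rewrite mulrA scalerBr scalerA mulVf ?gt_eqF//.
by rewrite scale1r.
Qed.

End dilation.

(** * Approximate identities in [L^1] *)

Section approximate_identity.
Variables (R : realType) (n : nat).
Local Notation V := 'rV[R]_n.
Local Notation mu := (lebesgue_rV R n).
Implicit Types (f g : V -> R[i]) (e d : R).

Lemma L1_translation_cont g : mem_Lp 1 g -> forall e, 0 < e ->
  exists2 d, 0 < d & forall h : V, (forall i, `|h ord0 i| <= d) ->
    (\int[mu]_x (normc (g (x - h) - g x))%:E <= e%:E)%E.
Proof.
move=> /mem_Lp1P gi e e0; have [mg _] := gi.
have /cintegrableP[/L1cont_integrable[m1 c1] /L1cont_integrable[m2 c2]] := gi.
have e2 : 0 < e / 2 by rewrite divr_gt0.
have [d1 d10 H1] := c1 _ e2; have [d2 d20 H2] := c2 _ e2.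
exists (Num.min d1 d2) => [|h hd]; first by rewrite lt_min d10.
have mgh : cmeasurable (fun x : V => g (x - h)).
  exact: (cmeasurable_comp (measurable_addrVr (- h)) mg).
have [n1 n2] := mgh.
apply: (@le_trans _ _ (L1shift (fun x => Re (g x)) (- h) +
                       L1shift (fun x => Im (g x)) (- h))%E); last first.
  rewrite [e]splitr EFinD; apply: leeD; [apply: H1|apply: H2] => i;
    rewrite mxE normrN (le_trans (hd i))// ge_min lexx ?orbT//.
have q1 : measurable_fun setT (fun x : V => `|Re (g (x - h)) - Re (g x)|%:E).
  by apply/measurable_EFinP; apply: measurableT_comp => //; exact: measurable_funB.
have q2 : measurable_fun setT (fun x : V => `|Im (g (x - h)) - Im (g x)|%:E).
  by apply/measurable_EFinP; apply: measurableT_comp => //; exact: measurable_funB.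
rewrite /L1shift -ge0_integralD//.
apply: ge0_le_integral => //.
- by move=> x _; rewrite lee_fin normc_ge0.
- by apply: measurable_enormc; exact: cmeasurableB.
- exact: emeasurable_funD.
- move=> x _; rewrite -EFinD lee_fin (le_trans (normc_le_ReIm _))//.
  by rewrite ReD ReN ImD ImN.
Qed.

Lemma L1_tail (G : V -> R) : measurable_fun setT G -> (forall x, 0 <= G x) ->
  (\int[mu]_x (G x)%:E < +oo)%E -> forall e, 0 < e -> exists k,
    (\int[mu]_x (G x * \1_(~` @cube R n k) x)%:E <= e%:E)%E.
Proof.
move=> mG G0 Goo e e0.
have mD k : measurable_fun setT (fun x => (G x * \1_(~` @cube R n k) x)%:E).
  apply/measurable_EFinP; apply: measurable_funM => //.
  by apply: measurable_indic; apply: measurableC; exact: measurable_cube.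
apply: (ecvg0_le e0).
rewrite -(integral0 mu setT).
apply: (@dominated_cvg _ _ _ mu setT measurableT _ _ (fun x => (G x)%:E)) => //.
- move=> x _; have : setT x by [].
  rewrite -(@bigcup_cube R n) => -[N _ xN].
  apply: cvg_near_cst; exists N => // k /= Nk.
  rewrite indicE memNset ?mulr0//= => nk; apply: nk.
  by move: x xN; exact/subsetPset/nondecreasing_cube.
- apply/integrableP; split; first exact/measurable_EFinP.
  by under eq_integral do rewrite gee0_abs ?lee_fin//.
- move=> k x _; rewrite gee0_abs ?lee_fin ?mulr_ge0//.
  by rewrite ler_piMr// indicE; case: (_ \in _).
Qed.

(** By Tonelli the norm is at most the integral over [z] of [|chi z|] times the [L^1] norm of
    [g (. - d z) - g]. That norm is small for [z] in a fixed cube once [d] is small, and at most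
    twice the norm of [g] outside the cube, where [chi] has little mass. The mass of [chi] is
    arbitrary: the result is used both for mass 0, to get a small norm, and for nonzero mass, to
    recover [g]. *)
Lemma approximate_identity g chi : mem_Lp 1 g -> mem_Lp 1 chi ->
  forall e, 0 < e -> exists2 d0, 0 < d0 & forall d, 0 < d -> d <= d0 ->
    (Lpnorm 1 (fun x => convolution g (dilate d chi) x - cint mu chi * g x)%R
       <= e%:E)%E.
Proof.
move=> g1 chi1 e e0.
have /mem_Lp1P [mg goo] := g1; have /mem_Lp1P [mchi chioo] := chi1.
have n0 (h : V -> R[i]) x : 0 <= normc (h x) by exact: normc_ge0.
set a := fine (\int[mu]_x (normc (chi x))%:E); set b := fine (\int[mu]_x (normc (g x))%:E).
have aE : (\int[mu]_x (normc (chi x))%:E = a%:E)%E.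
  by rewrite fineK// ge0_fin_numE//; apply: integral_ge0 => x _; rewrite lee_fin.
have bE : (\int[mu]_x (normc (g x))%:E = b%:E)%E.
  by rewrite fineK// ge0_fin_numE//; apply: integral_ge0 => x _; rewrite lee_fin.
have a0 : 0 <= a by rewrite fine_ge0//; apply: integral_ge0 => x _; rewrite lee_fin.
have b0 : 0 <= b by rewrite fine_ge0//; apply: integral_ge0 => x _; rewrite lee_fin.
(* Chosen so that [e1 * a] and [2 * b * e2] are each at most [e / 2]; adding 1 to the denominators
   covers vanishing norms. *)
pose e1 := e / 2 / (a + 1); pose e2 := e / 2 / (2 * b + 1).
have e10 : 0 < e1 by rewrite !divr_gt0// ltr_wpDl.
have e20 : 0 < e2 by rewrite !divr_gt0// ltr_wpDl// mulr_ge0.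
have [k Hk] := L1_tail (measurable_normc mchi) (n0 _) chioo e20.
have [d1 d10 Hd] := L1_translation_cont g1 e10.
(* For [z] in [cube k] the coordinates are at most [k.+1] in modulus, so those of [d *: z] are at
   most [d1]. *)
exists (d1 / k.+1%:R) => [|d dp dd]; first by rewrite divr_gt0.
pose A (p : V * V) : \bar R := (normc (g (p.1 - d *: p.2) - g p.1) * normc (chi p.2))%:E.
have mgs : cmeasurable (fun p : V * V => g (p.1 - d *: p.2)).
  have mp : measurable_fun setT (fun p : V * V => (p.1, d *: p.2)).
    apply/measurable_fun_pair => /=; first exact: measurable_fst.
    exact: (measurableT_comp (measurable_scalerV d) measurable_snd).
  exact: (cmeasurable_comp (measurableT_comp (@measurable_subrV R n) mp) mg).
have mA : measurable_fun setT A.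
  apply/measurable_EFinP; apply: measurable_funM; apply: measurable_normc.
    by apply: cmeasurableB => //; exact: (cmeasurable_comp measurable_fst mg).
  exact: (cmeasurable_comp measurable_snd mchi).
have A0 p : (0 <= A p)%E by rewrite lee_fin mulr_ge0// normc_ge0.
apply: (@le_trans _ _ (\int[mu]_x \int[mu]_z A (x, z)))%E.
  rewrite Lpnorm1; apply: ae_ge0_le_integral => //.
  - by move=> x _; rewrite lee_fin normc_ge0.
  - apply: measurable_enormc; apply: cmeasurableB.
      by apply: cmeasurable_conv => //; exact: cmeasurable_dilate.
    by apply: cmeasurableM => //; exact: cmeasurable_cst.
  - by move=> x _; exact: integral_ge0.
  - by apply: (@measurable_fun_fubini_tonelli_F _ _ _ _ _ mu A).
  have := ae_conv_integrable (lexx 1%E) g1 (mem_Lp1_dilate dp chi1).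
  apply: filterS => x xi _.
  have mx : cmeasurable (fun z : V => g (x - d *: z)).
    apply: (cmeasurable_comp _ mg).
    exact: (measurableT_comp (measurable_subrVl x) (measurable_scalerV d)).
  have xi' : cintegrable mu (fun z : V => g (x - d *: z) * chi z).
    have dn : 0 < d ^- n by rewrite invr_gt0 exprn_gt0.
    have := cintegrable_change (m1 := mu) (phi := fun x => d *: x) dn
      (measurable_scalerV d) _ xi.
    move=> /(_ (fun F mF F0 => ge0_integral_rV_scale dp mF F0)).
    (* Rescaling the integrable kernel of the convolution leaves the factor [d ^- n] of [dilate],
       which is cancelled here. *)
    move=> /(cintegrableZ (real_complex R (d ^+ n))); congr cintegrable.
    apply/funext => z; rewrite /= /dilate scalerA mulVf ?gt_eqF// scale1r.
    have dd1 : real_complex R (d ^+ n) * real_complex R (d ^- n) = 1.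
      by rewrite -rmorphM/= mulfV// expf_neq0 ?gt_eqF.
    by rewrite -[RHS]mul1r -dd1; ring.
  rewrite convr_dilateE// [cint mu chi * g x]mulrC -cintZ//.
  rewrite -cintB//; last by apply: cintegrableZ; exact/mem_Lp1P.
  apply: le_trans (normc_cint_le _ _) _.
    apply: cmeasurableB; apply: cmeasurableM => //; exact: cmeasurable_cst.
  rewrite le_eqVlt; apply/orP; left; apply/eqP; apply: eq_integral => z _.
  by rewrite -mulrBl ComplexField.Normc.normcM.
rewrite (fubini_tonelli A mA A0).
pose Om z := (\int[mu]_x (normc (g (x - d *: z) - g x))%:E)%E.
have mgz z : cmeasurable (fun x : V => g (x - d *: z)).
  exact: (cmeasurable_comp (measurable_addrVr (- (d *: z))) mg).
have OmE z : (\int[mu]_x A (x, z) = Om z * (normc (chi z))%:E)%E.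
  rewrite -ge0_integralZr//.
  - by apply: measurable_enormc; exact: cmeasurableB.
  - by move=> x _; rewrite lee_fin normc_ge0.
  - by rewrite lee_fin.
have Om2b z : (Om z <= (2 * b)%:E)%E.
  apply: (@le_trans _ _ (\int[mu]_x (normc (g (x - d *: z)))%:E + \int[mu]_x (normc (g x))%:E))%E.
    rewrite -ge0_integralD//; last 4 first.
    - by move=> x _; rewrite lee_fin.
    - exact: measurable_enormc.
    - by move=> x _; rewrite lee_fin.
    - exact: measurable_enormc.
    apply: ge0_le_integral => //.
    - by move=> x _; rewrite lee_fin normc_ge0.
    - by apply: measurable_enormc; exact: cmeasurableB.
    - by apply: emeasurable_funD; exact: measurable_enormc.
    - by move=> x _; rewrite -EFinD lee_fin normcB.
  rewrite (ge0_integral_rV_translate (- (d *: z)) (F := fun x => (normc (g x))%:E)).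
  - by rewrite bE -EFinD lee_fin mulr_natl mulr2n.
  - exact: measurable_enormc.
  - by move=> x; rewrite lee_fin.
have Omd z : @cube R n k z -> (Om z <= e1%:E)%E.
  move=> zk; apply: Hd => i; rewrite mxE normrM gtr0_norm//.
  have zi : `|z ord0 i| <= k.+1%:R.
    by have := zk i; rewrite /= !mxE in_itv/= ler_norml => /andP[/ltW -> ->].
  rewrite (le_trans (ler_wpM2l (ltW dp) zi))//.
  by rewrite -ler_pdivlMr.
have mC : measurable_fun setT (fun x => (normc (chi x))%:E) by exact: measurable_enormc.
have mT : measurable_fun setT (fun x => (normc (chi x) * \1_(~` @cube R n k) x)%:E).
  apply/measurable_EFinP; apply: measurable_funM; first exact: measurable_normc.
  by apply: measurable_indic; apply: measurableC; exact: measurable_cube.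
apply: (@le_trans _ _ (\int[mu]_z (e1%:E * (normc (chi z))%:E +
    (2 * b)%:E * (normc (chi z) * \1_(~` @cube R n k) z)%:E)))%E.
  apply: ge0_le_integral => //.
  - by move=> z _; exact: integral_ge0.
  - by apply: (@measurable_fun_fubini_tonelli_G _ _ _ _ _ mu A).
  - by apply: emeasurable_funD; exact: measurable_funeM.
  move=> z _; rewrite OmE indicE.
  have [zk|zk] := pselect (@cube R n k z).
    rewrite memNset; last by move=> /(_ zk).
    by rewrite mulr0 mule0 adde0 lee_wpmul2r ?lee_fin//; exact: Omd.
  rewrite mem_set// mulr1 -[leLHS]add0e; apply: leeD.
    by apply: mule_ge0; rewrite lee_fin ?n0//; apply: ltW.
  by rewrite lee_wpmul2r ?lee_fin.
rewrite ge0_integralD//; last 4 first.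
- by move=> z _; apply: mule_ge0; rewrite lee_fin ?n0//; apply: ltW.
- exact: measurable_funeM.
- by move=> z _; apply: mule_ge0; rewrite lee_fin ?mulr_ge0 ?n0.
- exact: measurable_funeM.
rewrite ge0_integralZl//; last 2 first.
- by move=> z _; rewrite lee_fin.
- by rewrite lee_fin ltW.
rewrite ge0_integralZl//; last 2 first.
- by move=> z _; rewrite lee_fin mulr_ge0.
- by rewrite lee_fin mulr_ge0.
rewrite aE [e]splitr EFinD; apply: leeD.
  rewrite -EFinM lee_fin /e1 mulrAC ler_pdivrMr ?ltr_wpDl// ler_wpM2l ?divr_ge0 ?ltW//.
  by rewrite ltrDl.
apply: (@le_trans _ _ ((2 * b)%:E * e2%:E))%E.
  by rewrite lee_wpmul2l// lee_fin mulr_ge0.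
rewrite -EFinM lee_fin /e2 mulrA ler_pdivrMr ?ltr_wpDl ?mulr_ge0//.
by rewrite mulrC ler_wpM2l ?divr_ge0 ?ltW// ltrDl.
Qed.

End approximate_identity.

(** * Injectivity of the Fourier transform on L^1 *)

Section fourier_theory.
Variables (R : realType) (n : nat).
Local Notation V := 'rV[R]_n.
Local Notation mu := (lebesgue_rV R n).
Implicit Types (f g h : V -> R[i]) (e d : R) (x y xi u : V).

Lemma conjc_mulK (z w : R[i]) : conjc (z * conjc w) = conjc z * w.
Proof.
case: z => a b; case: w => c e; apply/eqP; rewrite eq_complex /=.
by apply/andP; split; apply/eqP; ring.
Qed.

Definition expi (xi x : V) : R[i] := Complex (cos (dot x xi)) (- sin (dot x xi)).

Lemma fourierE g xi : fourier g xi = cint mu (fun x => g x * expi xi x).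
Proof. by []. Qed.

Lemma dotC x y : dot x y = dot y x.
Proof. by apply: eq_bigr => i _; rewrite mulrC. Qed.

Lemma dotDl x y xi : dot (x + y) xi = dot x xi + dot y xi.
Proof. by rewrite /dot -big_split; apply: eq_bigr => i _; rewrite /= mxE mulrDl. Qed.

Lemma dotZl e x xi : dot (e *: x) xi = e * dot x xi.
Proof. by rewrite /dot mulr_sumr; apply: eq_bigr => i _; rewrite mxE mulrA. Qed.

Lemma expiC xi x : expi xi x = expi x xi.
Proof. by rewrite /expi dotC. Qed.

Lemma expiD xi x y : expi xi (x + y) = expi xi x * expi xi y.
Proof.
rewrite /expi dotDl cosD sinD; apply/eqP; rewrite eq_complex /=.
by apply/andP; split; apply/eqP; ring.
Qed.

Lemma expiZ xi e x : expi xi (e *: x) = expi (e *: xi) x.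
Proof. by rewrite /expi dotZl [dot x (e *: xi)]dotC dotZl [dot xi x]dotC. Qed.

Lemma expiN xi x : expi xi (- x) = conjc (expi xi x).
Proof. by rewrite -scaleN1r /expi dotZl mulN1r cosN sinN. Qed.

Lemma expiNN xi x : expi (- xi) (- x) = expi xi x.
Proof. by rewrite -[- x]scaleN1r expiZ scaleN1r opprK. Qed.

Lemma expi0 xi : expi xi 0 = 1.
Proof.
rewrite -(scale0r 0) /expi dotZl mul0r cos0 sin0 oppr0.
by [].
Qed.

Lemma expi_mulN xi x : expi xi x * expi (- xi) x = 1.
Proof. by rewrite !(expiC _ x) -expiD subrr expi0. Qed.

Lemma normc_expi xi x : normc (expi xi x) = 1.
Proof. by rewrite normcE /= sqrrN cos2Dsin2 sqrtr1. Qed.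

Lemma measurable_dot : measurable_fun setT (fun z : V * V => dot z.1 z.2).
Proof.
apply: measurable_sum => i; apply: measurable_funM.
  exact: (measurableT_comp (measurable_coord i) measurable_fst).
exact: (measurableT_comp (measurable_coord i) measurable_snd).
Qed.

Lemma cmeasurable_expi2 : cmeasurable (fun z : V * V => expi z.1 z.2).
Proof.
have md : measurable_fun setT (fun z : V * V => dot z.2 z.1).
  by under eq_fun do rewrite dotC; exact: measurable_dot.
split => /=.
  apply: (measurableT_comp (f := @cos R)) => //.
  by apply: continuous_measurable_fun; exact: continuous_cos.
apply: measurableT_comp => //; apply: (measurableT_comp (f := @sin R)) => //.
by apply: continuous_measurable_fun; exact: continuous_sin.
Qed.

Lemma cmeasurable_expi xi : cmeasurable (expi xi).
Proof.
apply: (cmeasurable_comp (phi := fun x : V => (xi, x)) _ cmeasurable_expi2).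
by apply/measurable_fun_pair => //; exact: measurable_cst.
Qed.

Lemma cintegrable_expi g xi : cintegrable mu g ->
  cintegrable mu (fun x => g x * expi xi x).
Proof.
move=> [mg goo]; split; first by apply: cmeasurableM => //; exact: cmeasurable_expi.
by under eq_integral do rewrite ComplexField.Normc.normcM normc_expi mulr1.
Qed.

(** Characters are eigenfunctions of convolution operators, and the Fourier transform is the
    eigenvalue. *)
Lemma conv_expi g xi x : cintegrable mu g ->
  convolution (expi (- xi)) g x = expi (- xi) x * fourier g xi.
Proof.
move=> gi; rewrite convE fourierE -cintZ; last exact: cintegrable_expi.
by apply: eq_cint => y; rewrite expiD expiNN; ring.
Qed.

(** Associativity of convolution for the character [expi (- xi)], [g] and [h], read at the origin:
    both sides are eigenvalues. *)
Lemma fourier_conv g h xi : mem_Lp 1 g -> mem_Lp 1 h ->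
  fourier (convolution g h) xi = fourier g xi * fourier h xi.
Proof.
move=> g1 h1; have /mem_Lp1P gi := g1; have /mem_Lp1P hi := h1.
have /mem_Lp1P ghi := mem_Lp_conv (lexx 1%E) g1 h1.
have := @convA_at _ _ (expi (- xi)) g h 0 (cmeasurable_expi _) gi.1 hi.1.
under eq_integral do rewrite normc_expi mul1e.
move=> /(_ (integral_econv_lty g1 h1)).
rewrite (conv_expi _ _ ghi) expi0 mul1r => <-.
have -> : convolution (expi (- xi)) g = (fun x => expi (- xi) x * fourier g xi).
  by apply/funext => x; exact: conv_expi.
rewrite convE (fourierE h) -cintZ; last exact: cintegrable_expi.
by apply: eq_cint => y; rewrite sub0r expiNN; ring.
Qed.

Lemma fourierB g h xi : mem_Lp 1 g -> mem_Lp 1 h ->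
  fourier (fun x => g x - h x) xi = fourier g xi - fourier h xi.
Proof.
move=> /mem_Lp1P gi /mem_Lp1P hi; rewrite !fourierE -cintB; try exact: cintegrable_expi.
by apply: eq_cint => x; rewrite mulrBl.
Qed.

Lemma fourier_dilate e g xi : 0 < e -> cmeasurable g ->
  fourier (dilate e g) xi = fourier g (e *: xi).
Proof.
move=> e0 mg; rewrite !fourierE -[RHS](cint_dilate e0); last first.
  by apply: cmeasurableM => //; exact: cmeasurable_expi.
apply: eq_cint => x; rewrite /dilate -mulrA; congr (_ * (_ * _)).
by rewrite -expiZ scalerA mulfV ?gt_eqF// scale1r.
Qed.

Lemma normc_fourier_le g xi : cmeasurable g -> ((normc (fourier g xi))%:E <= Lpnorm 1 g)%E.
Proof.
move=> mg; rewrite fourierE Lpnorm1 (le_trans (normc_cint_le _ _))//.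
  by apply: cmeasurableM => //; exact: cmeasurable_expi.
by under eq_integral do rewrite ComplexField.Normc.normcM normc_expi mulr1.
Qed.

Lemma cmeasurable_fourier_kernel g : cmeasurable g ->
  cmeasurable (fun z : V * V => g z.2 * expi z.1 z.2).
Proof.
move=> mg; apply: cmeasurableM; last exact: cmeasurable_expi2.
exact: (cmeasurable_comp measurable_snd mg).
Qed.

Lemma cmeasurable_fourier g : cmeasurable g -> cmeasurable (fourier g).
Proof.
by move=> mg; exact: (cmeasurable_cint mu (cmeasurable_fourier_kernel mg)).
Qed.

Lemma cint_conj g : cintegrable mu g ->
  cint mu (fun x => conjc (g x)) = conjc (cint mu g).
Proof.
move=> /cintegrableP[g1 g2]; rewrite /cint; congr Complex.
  by congr fine; apply: eq_integral => x _; case: (g x).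
rewrite /Rintegral -[- _](mulN1r) -RintegralZl//.
by congr fine; apply: eq_integral => x _; case: (g x) => a b; rewrite mulN1r.
Qed.

Lemma fourier_conj_reflect g xi : mem_Lp 1 g ->
  fourier (fun x => conjc (g (- x))) xi = conjc (fourier g xi).
Proof.
move=> /mem_Lp1P gi; have mg := gi.1.
rewrite !fourierE -cint_conj; last exact: cintegrable_expi.
rewrite -[RHS](cint_reflect 0); last first.
  by apply: cmeasurable_conj; apply: cmeasurableM => //; exact: cmeasurable_expi.
by apply: eq_cint => x; rewrite sub0r expiN conjc_mulK.
Qed.

Lemma mem_Lp1_conj_reflect g : mem_Lp 1 g -> mem_Lp 1 (fun x => conjc (g (- x))).
Proof.
move=> /mem_Lp1P [mg goo]; apply/mem_Lp1P.
have mr : measurable_fun setT (fun x : V => - x).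
  by have := measurable_subrVl (0 : V); congr measurable_fun; apply/funext => x; rewrite sub0r.
split; first by apply: cmeasurable_conj; exact: (cmeasurable_comp mr mg).
under eq_integral do rewrite normc_conj -sub0r.
rewrite (ge0_integral_rV_reflect 0 (F := fun x => (normc (g x))%:E))//.
  exact: measurable_enormc.
by move=> x; rewrite lee_fin normc_ge0.
Qed.

(* By Fubini, the convolution of [g] with [dilate d (fourier k)] is a
   superposition of values of [fourier g]. *)
Lemma conv_dilate_fourier g k d x : 0 < d -> mem_Lp 1 g -> mem_Lp 1 k ->
  (forall xi, fourier g xi = 0) -> convolution g (dilate d (fourier k)) x = 0.
Proof.
move=> d0 g1 k1 g0.
have /mem_Lp1P gi := g1; have /mem_Lp1P ki := k1.
have mg := gi.1; have mk := ki.1.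
rewrite convr_dilateE//; last exact: cmeasurable_fourier.
pose F (z : V * V) := g (x - d *: z.1) * (k z.2 * expi z.1 z.2).
have mgx : cmeasurable (fun z : V => g (x - d *: z)).
  apply: (cmeasurable_comp _ mg).
  exact: (measurableT_comp (measurable_subrVl x) (measurable_scalerV d)).
have mF : cmeasurable F.
  apply: cmeasurableM; last exact: cmeasurable_fourier_kernel.
  exact: (cmeasurable_comp measurable_fst mgx).
have gxoo : (\int[mu]_z (normc (g (x - d *: z)))%:E < +oo)%E.
  rewrite (ge0_integral_rV_scale (F := fun z => (normc (g (x - z)))%:E) d0).
  - rewrite (ge0_integral_rV_reflect x (F := fun z => (normc (g z))%:E)).
    + by rewrite lte_mul_pinfty ?lee_fin ?invr_ge0 ?exprn_ge0 ?ltW//; exact: gi.2.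
    + exact: measurable_enormc.
    + by move=> y; rewrite lee_fin normc_ge0.
  - apply: measurable_enormc; exact: (cmeasurable_comp (measurable_subrVl x) mg).
  - by move=> y; rewrite lee_fin normc_ge0.
have k0 : (0 <= \int[mu]_x (normc (k x))%:E)%E.
  by apply: integral_ge0 => y _; rewrite lee_fin normc_ge0.
have iF : cintegrable (mu \x mu)%E F.
  split=> //; rewrite fubini_tonelli1//=.
  - have gx0 : (0 <= \int[mu]_z (normc (g (x - d *: z)))%:E)%E.
      by apply: integral_ge0 => y _; rewrite lee_fin normc_ge0.
    apply: (@le_lt_trans _ _ ((\int[mu]_z (normc (g (x - d *: z)))%:E) *
        \int[mu]_x (normc (k x))%:E)%E); last first.
      by rewrite lte_mul_pinfty ?ge0_fin_numE//; exact: ki.2.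
    rewrite -(ge0_integralZr _ measurableT (measurable_enormc mgx)
      (fun x _ => normc_ge0 _) k0).
    rewrite le_eqVlt; apply/orP; left; apply/eqP.
    apply: eq_integral => z _; rewrite /fubini_F /F /=.
    under eq_integral do rewrite !ComplexField.Normc.normcM normc_expi mulr1 EFinM.
    rewrite ge0_integralZl//.
    + by apply: measurable_enormc.
    + by move=> y _; rewrite lee_fin normc_ge0.
    + by rewrite lee_fin normc_ge0.
  - exact: measurable_enormc.
  - by move=> z; rewrite lee_fin normc_ge0.
transitivity (cint mu (fun z => cint mu (fun u => F (z, u)))).
  apply: eq_cint => z; rewrite fourierE /F/= cintZ//.
  exact: cintegrable_expi.
rewrite (cint_fubini iF) /F/=.
transitivity (cint mu (fun u : V => (0 : R[i]))); last first.
  by rewrite /cint /Rintegral integral0.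
apply: eq_cint => u.
(* Since [expi z u] is the character of frequency [d^-1 u] at [d z], it is, up to a factor
   independent of [z], the character of frequency [- d^-1 u] at [x - d z]. The integral over [z] is
   thus a multiple of [fourier g] at [- d^-1 u]. *)
pose H (y : V) := g y * expi (- (d^-1 *: u)) y.
have Hi : cintegrable mu H by exact: cintegrable_expi.
have mH := Hi.1.
have E z : g (x - d *: z) * (k u * expi z u) =
    (k u * expi (d^-1 *: u) x) * H (x - d *: z).
  rewrite /H expiD expiNN expiZ scalerA mulfV ?gt_eqF// scale1r (expiC z u).
  by rewrite -[LHS]mulr1 -(expi_mulN (d^-1 *: u) x); ring.
under eq_cint do rewrite E.
rewrite cintZ_weak; last first.
  apply: cintegrableZ; split.
    exact: (cmeasurable_comp
      (measurableT_comp (measurable_subrVl x) (measurable_scalerV d)) mH).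
  by under eq_integral do rewrite /H ComplexField.Normc.normcM normc_expi mulr1.
rewrite (_ : cint mu _ = 0) ?mulr0//.
rewrite (cint_scale (g := fun z => H (x - z)) d0).
  by rewrite cint_reflect// -fourierE g0 mulr0.
exact: (cmeasurable_comp (measurable_subrVl x) mH).
Qed.

(* The Fourier transform [K] of [zeta * conj (zeta (- .))] is [|fourier zeta|^2]:
   it has compact support and positive integral, and [g * K_d = 0] for all [d],
   so the approximate identity [K_d / \int K] yields [g = 0]. *)
Lemma fourier_inj g (zeta : V -> R[i]) : lp_cutoff zeta -> mem_Lp 1 zeta -> mem_Lp 1 g ->
  (forall xi, fourier g xi = 0) -> {ae mu, forall x, g x = 0}.
Proof.
move=> [_ zsupp [U [_ U1 zU]]] z1 g1 g0.
have n0 (h : V -> R[i]) x : 0 <= normc (h x) by exact: normc_ge0.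
have z1' := mem_Lp1_conj_reflect z1.
pose k := convolution zeta (fun x => conjc (zeta (- x))).
have k1 : mem_Lp 1 k by exact: mem_Lp_conv.
have mk := mem_Lp_meas k1.
pose K := fourier k.
have KE xi : K xi = real_complex R (normc (fourier zeta xi) ^+ 2).
  by rewrite /K fourier_conv// fourier_conj_reflect// mulc_conj.
have mK : cmeasurable K by exact: cmeasurable_fourier.
(* [cube 1] has half-side 2, so it contains the ball of radius 2 in which [fourier zeta] is
   supported. *)
have K0 xi : ~ @cube R n 1 xi -> K xi = 0.
  move=> xic; rewrite KE; have [->|zn0] := eqVneq (fourier zeta xi) 0.
    by rewrite ComplexField.Normc.normc0 expr0n.
  exfalso; apply: xic => i; rewrite /= !mxE in_itv/=.
  have : enorm xi < 2 by apply: zsupp; apply: subset_closure.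
  rewrite /enorm => xi2.
  have : `|xi ord0 i| <= Num.sqrt (dot xi xi).
    rewrite -sqrtr_sqr ler_wsqrtr// /dot (bigD1 i)//= expr2 lerDl.
    by apply: sumr_ge0 => j _; rewrite -expr2 sqr_ge0.
  move=> /le_lt_trans/(_ xi2); rewrite ltr_norml => /andP[-> /ltW ->] //.
have [kf ] : exists M, forall xi, normc (K xi) <= M.
  exists (fine (Lpnorm 1 k)) => xi; rewrite -lee_fin fineK ?normc_fourier_le//.
  by rewrite ge0_fin_numE ?Lpnorm_ge0//; case: k1.
move=> KM.
have kf0 : 0 <= kf by apply: le_trans (KM 0).
have K1 : mem_Lp 1 K.
  apply/mem_Lp1P; apply: (@cintegrable_le _ _ _ _ _ (fun x => kf * \1_(@cube R n 1) x)) => //.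
  - by apply: measurable_funM => //; apply: measurable_indic; exact: measurable_cube.
  - move=> x; rewrite indicE; have [xc|/negP xc] := boolP (x \in @cube R n 1).
      by rewrite mulr1.
    by rewrite K0 ?ComplexField.Normc.normc0 ?mulr0// => /mem_set.
  - under eq_integral do rewrite EFinM.
    rewrite ge0_integralZl//.
    + rewrite integral_indic ?setIT//; last exact: measurable_cube.
      by rewrite lte_mul_pinfty// cube_lty.
    + by apply/measurable_EFinP; apply: measurable_indic; exact: measurable_cube.
have /mem_Lp1P Ki := K1.
have cK0 : cint mu K != 0.
  apply/eqP => /(congr1 (@complex.Re R)) /= H.
  have [/integrable_fin_num Kfin _] := (cintegrableP _ _).1 Ki.
  have I0 : (\int[mu]_x (Re (K x))%:E = 0)%E.
    by rewrite -[LHS]fineK ?Kfin// -[X in X%:E]/(\int[mu]_x Re (K x)) H.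
  (* If every [|xi_i| <= c] then the squares sum to at most [n * c <= 1], because [c <= 1]. The box
     [Q] is thus inside the unit ball, where [fourier zeta], hence [K], is 1, and its positive
     volume bounds the integral of [K] from below. *)
  pose c : R := n.+1%:R^-1.
  have c0 : 0 < c by rewrite invr_gt0.
  pose Q : set V := boxoc (const_mx (- c)) (const_mx c).
  have mQ : measurable Q by exact: measurable_boxoc.
  have Qpos : (0 < mu Q)%E.
    rewrite lebesgue_rV_boxoc; last by move=> i; rewrite !mxE -subr_gt0 opprK addr_gt0.
    by rewrite lte_fin prodr_gt0// => i _; rewrite !mxE opprK addr_gt0.
  suff : (mu Q <= \int[mu]_x (Re (K x))%:E)%E by rewrite I0 leNgt Qpos.
  rewrite -[X in mu X]setIT -integral_indic//; apply: ge0_le_integral => //.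
  - by apply/measurable_EFinP; exact: measurable_indic.
  - by apply/measurable_EFinP; case: mK.
  - move=> xi _; rewrite lee_fin KE indicE.
    have -> : Re (real_complex R (normc (fourier zeta xi) ^+ 2)) =
      normc (fourier zeta xi) ^+ 2 by [].
    have [/set_mem xiQ|_] := boolP (xi \in Q); last by rewrite sqr_ge0.
    rewrite zU ?ComplexField.Normc.normc1 ?expr1n//; apply: U1.
    rewrite /= /enorm -sqrtr1 ler_wsqrtr// /dot.
    apply: (@le_trans _ _ (\sum_(i < n) c)).
      apply: ler_sum => i _; have := xiQ i; rewrite /= !mxE in_itv/=.
      have c1 : c <= 1 by rewrite invf_le1// ler1n.
      move=> /andP[x1 x2]; nra.
    rewrite sumr_const card_ord -mulr_natl ler_pdivrMr// mul1r ler_nat//.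
have gK0 d : 0 < d -> convolution g (dilate d K) = (fun=> 0).
  by move=> d0; apply/funext => x; exact: conv_dilate_fourier.
have ng : (Lpnorm 1 g = 0)%E.
  apply/eqP; rewrite eq_le Lpnorm_ge0 andbT; apply/lee_addgt0Pr => e e0.
  have nK : 0 < normc (cint mu K).
    rewrite lt_neqAle normc_ge0 andbT eq_sym; apply: contra cK0 => /eqP.
    by move=> /ComplexField.Normc.eq0_normc ->.
  (* The convolutions vanish, so what remains is the norm of [g] times the modulus of the mass of
     [K]; the tolerance is scaled by the same modulus, to be cancelled. *)
  have [d0 d00 Hd] := approximate_identity g1 K1 (mulr_gt0 nK e0).
  have := Hd d0 d00 (lexx _); rewrite gK0// Lpnorm1.
  under eq_integral do rewrite sub0r normcN ComplexField.Normc.normcM EFinM.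
  rewrite ge0_integralZl//.
  - by rewrite -Lpnorm1 EFinM lee_pmul2l ?lte_fin// add0e.
  - by apply: measurable_enormc; exact: (mem_Lp_meas g1).
  - by move=> x _; rewrite lee_fin.
  - by rewrite lee_fin ltW.
have mg := mem_Lp_meas g1.
have := ae_eq_integral_abs mu measurableT (measurable_enormc mg).
rewrite Lpnorm1 in ng; case=> + _.
under eq_integral do rewrite gee0_abs ?lee_fin//.
move=> /(_ ng); apply: filterS => x /(_ I) [].
exact: ComplexField.Normc.eq0_normc.
Qed.

End fourier_theory.

(** * Integrability of Schwartz functions *)

Section schwartz_integrable.
Variables (R : realType).

(** The measurable sets are generated by the coordinates whereas continuity refers to the topology;
    this links the two. An open set is the union of the cells it contains among the grids of mesh
    [1 / k.+1], and these cells are countably many, enumerated by [unpickle]. *)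
Lemma open_measurable_rV n (U : set 'rV[R]_n) : open U -> measurable U.
Proof.
move=> oU.
pose box (p : nat * 'rV[int]_n) : set 'rV[R]_n :=
  [set x | forall i, `[(p.2 ord0 i)%:~R / p.1.+1%:R,
                       (p.2 ord0 i + 1)%:~R / p.1.+1%:R[%classic (x ord0 i)].
have mbox p : measurable (box p).
  by apply: (@measurable_box _ _ (fun i => `[(p.2 ord0 i)%:~R / p.1.+1%:R,
    (p.2 ord0 i + 1)%:~R / p.1.+1%:R[%classic)) => i; exact: measurable_itv.
pose F (m : nat) := if unpickle m is Some p then
  if `[< box p `<=` U >] then box p else set0 else set0.
have -> : U = \bigcup_m F m.
  apply/seteqP; split => [x Ux|x [m _]]; last first.
    by rewrite /F; case: (unpickle m) => [p|//]; case: asboolP => // + xp; exact.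
  have /nbhs_ballP[e /= e0 xeU] : nbhs x U by exact: open_nbhs_nbhs.
  have [k ke] : exists k : nat, k.+1%:R^-1 < e.
    exists (Num.truncn e^-1); rewrite -[ltRHS]invrK ltf_pV2 ?posrE ?invr_gt0//.
    exact: truncnS_gt.
  pose z : 'rV[int]_n := \row_i Num.floor (x ord0 i * k.+1%:R).
  have xbox : box (k, z) x.
    move=> i; rewrite /= in_itv/= !mxE ler_pdivrMr// ltr_pdivlMr//.
    by rewrite floor_le_tmp floorD1_gt.
  have boxU : box (k, z) `<=` U.
    move=> y yb; apply: xeU; split=> // i j; rewrite (_ : i = ord0); last exact: ord1.
    have := xbox j; have := yb j; rewrite /= !in_itv/=.
    move=> /andP[y1 y2] /andP[x1 x2].
    apply: (le_lt_trans _ ke).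
    have E : (z ord0 j + 1)%:~R / k.+1%:R = (z ord0 j)%:~R / k.+1%:R + k.+1%:R^-1 :> R.
      by rewrite intrD mulrDl mul1r.
    rewrite E in x2 y2.
    have D (a b u v : R) : a <= u -> u < a + b -> a <= v -> v < a + b -> `|u - v| <= b.
      by move=> *; rewrite ler_norml; apply/andP; split; lra.
    exact: D x1 x2 y1 y2.
  exists (pickle (k, z)) => //; rewrite /F pickleK.
  by case: asboolP.
apply: bigcupT_measurable => m; rewrite /F; case: (unpickle m) => [p|//].
by case: asboolP.
Qed.

Lemma continuous_measurable_rV n (h : 'rV[R]_n -> R) : continuous h ->
  measurable_fun setT h.
Proof.
move=> ch; apply: (measurability _ (RGenOInfty.measurableE R)) => //.
move=> _ [_ [a ->] <-]; rewrite setTI; apply: open_measurable_rV.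
by apply: open_comp => // x _; exact: ch.
Qed.

Let bump (t : R) : R := (1 + t ^+ 2)^-1.

Let bump_ge0 t : 0 <= bump t.
Proof. by rewrite invr_ge0 addr_ge0// sqr_ge0. Qed.

Let measurable_bump : measurable_fun setT bump.
Proof. by apply: continuous_measurable_fun; exact: continuous_oneDsqrV. Qed.

Lemma measurable_prod_oneDsqr n :
  measurable_fun setT (fun x : 'rV[R]_n => \prod_(i < n) (1 + x ord0 i ^+ 2)^-1).
Proof.
apply: measurable_prod => i _.
exact: (measurableT_comp measurable_bump (measurable_coord i)).
Qed.

Lemma integral_oneDsqr_lty :
  (\int[@lebesgue_measure R]_t ((1 + t ^+ 2)^-1)%:E < +oo)%E.
Proof.
rewrite (ge0_symfun_integralT bump_ge0).
- rewrite (_ : [set _ | _] = `[0, +oo[%classic); last first.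
    by apply/seteqP; split => x/=; rewrite in_itv/= andbT.
  by rewrite integral0y_oneDsqr ltry.
- exact: continuous_oneDsqrV.
- by move=> t /=; rewrite /bump sqrrN.
Qed.

Lemma integral_prod_oneDsqr n :
  (\int[lebesgue_rV R n]_x (\prod_(i < n) (1 + x ord0 i ^+ 2)^-1)%:E < +oo)%E.
Proof.
have p0 m (x : 'rV[R]_m) : (0 <= (\prod_(i < m) (1 + x ord0 i ^+ 2)^-1)%:E)%E.
  by rewrite lee_fin; apply: prodr_ge0 => i _; exact: bump_ge0.
elim: n => [|n IH].
  under eq_integral do rewrite big_ord0.
  by rewrite integral_cst//= diracE mem_set// mule1 ltry.
rewrite ge0_integral_lebesgue_rVS//; last first.
  by apply/measurable_EFinP; exact: measurable_prod_oneDsqr.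
set I := (\int[_]_x _)%E in IH.
have I0 : (0 <= I)%E by apply: integral_ge0 => x _; exact: p0.
have E t : (\int[lebesgue_rV R n]_x
    (\prod_(i < n.+1) (1 + cons_rV (t, x) ord0 i ^+ 2)^-1)%:E = (bump t)%:E * I)%E.
  rewrite -ge0_integralZl//.
  - apply: eq_integral => x _; rewrite big_ord_recl -EFinM; congr (_ * _)%:E.
      by rewrite mxE unlift_none.
    by apply: eq_bigr => i _; rewrite mxE liftK.
  - by apply/measurable_EFinP; exact: measurable_prod_oneDsqr.
  - by rewrite lee_fin bump_ge0.
under eq_integral do rewrite E.
rewrite ge0_integralZr//.
- rewrite lte_mul_pinfty//.
  + by apply: integral_ge0 => t _; rewrite lee_fin bump_ge0.
  + rewrite ge0_fin_numE; first exact: integral_oneDsqr_lty.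
    by apply: integral_ge0 => t _; rewrite lee_fin bump_ge0.
- exact/measurable_EFinP.
- by move=> t _; rewrite lee_fin bump_ge0.
Qed.

(** Expanding the product of the [1 + x_i ^+ 2] yields one monomial with exponents 0 or 2 for each
    subset of the coordinates, encoded by [f]. Each is controlled by a seminorm without derivatives,
    and [C] is the sum of the bounds. *)
Lemma schwartz_real_bound n (h : 'rV[R]_n -> R) : schwartz_real h ->
  exists C, 0 <= C /\ forall x, `|h x| <= C * \prod_(i < n) (1 + x ord0 i ^+ 2)^-1.
Proof.
move=> [_ bh].
have [M HM] : exists M : {ffun 'I_n -> bool} -> R, forall (f : {ffun 'I_n -> bool}) (x : 'rV[R]_n),
    `|(\prod_i x ord0 i ^+ (2 * f i)) * h x| <= M f.
  have H (f : {ffun 'I_n -> bool}) := bh (fun i => 2 * f i)%N [::].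
  exists (fun f => projT1 (cid (H f))) => f x.
  by case: cid => M /=; apply.
have P0 (x : 'rV[R]_n) : 0 < \prod_(i < n) (1 + x ord0 i ^+ 2).
  by apply: prodr_gt0 => i _; rewrite ltr_wpDr// sqr_ge0.
exists (\sum_f M f); split.
  by apply: sumr_ge0 => f _; apply: le_trans (HM f 0); exact: normr_ge0.
move=> x; rewrite prodfV ler_pdivlMr// -[X in _ * X]gtr0_norm// -normrM.
rewrite (_ : \prod_(i < n) (1 + x ord0 i ^+ 2) =
    \sum_(f : {ffun 'I_n -> bool}) \prod_(i < n) x ord0 i ^+ (2 * f i)).
  rewrite mulr_sumr (le_trans (ler_norm_sum _ _ _))//.
  by apply: ler_sum => f _; rewrite mulrC.
rewrite -(bigA_distr_bigA (fun i b => x ord0 i ^+ (2 * nat_of_bool b))).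
by apply: eq_bigr => i _; rewrite big_bool /= muln1 muln0 expr0 addrC.
Qed.

Lemma schwartz_real_integrable n (h : 'rV[R]_n -> R) : schwartz_real h ->
  (lebesgue_rV R n).-integrable setT (fun x => (h x)%:E).
Proof.
move=> sh; have [C [C0 hC]] := schwartz_real_bound sh.
have mh : measurable_fun setT h.
  apply: continuous_measurable_rV => x.
  by case: sh => dh _; exact: (differentiable_continuous (dh [::] x)).
have mP : measurable_fun setT (fun x : 'rV[R]_n => (\prod_(i < n) (1 + x ord0 i ^+ 2)^-1)).
  exact: measurable_prod_oneDsqr.
apply/integrableP; split; first exact/measurable_EFinP.
apply: (@le_lt_trans _ _ (\int[lebesgue_rV R n]_x
   (C%:E * (\prod_(i < n) (1 + x ord0 i ^+ 2)^-1)%:E)))%E.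
  apply: ge0_le_integral => //.
  - by apply: measurableT_comp => //; exact/measurable_EFinP.
  - by apply: measurable_funeM; exact/measurable_EFinP.
  - by move=> x _; rewrite /= -EFinM lee_fin.
rewrite ge0_integralZl//.
- by rewrite lte_mul_pinfty//; exact: integral_prod_oneDsqr.
- exact/measurable_EFinP.
- move=> x _; rewrite lee_fin; apply: prodr_ge0 => i _.
  by rewrite invr_ge0 addr_ge0// sqr_ge0.
Qed.

Lemma schwartz_mem_Lp1 n (g : 'rV[R]_n -> R[i]) : schwartz g -> mem_Lp 1 g.
Proof.
move=> [s1 s2]; apply/mem_Lp1P/cintegrableP.
by split; exact: schwartz_real_integrable.
Qed.

End schwartz_integrable.

(** * Littlewood-Paley blocks *)

(** The finiteness of [N] carries the argument: an infinite [N] would satisfy the last inequality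
    whatever [D] and [B] are. *)
Lemma le_half_absorb (R : realType) (N D B : \bar R) :
  (0 <= N -> 0 <= D -> 0 <= B -> N < +oo -> D < +oo -> B < +oo ->
  N <= D * B + N * (2^-1)%:E -> N <= 2%:E * B * D)%E.
Proof.
case: N D B => [N| |] [D| |] [B| |]//=; rewrite !lee_fin => _ _ _ _ _ _ H; lra.
Qed.

Section littlewood_paley_blocks.
Variables (R : realType) (n : nat).
Local Notation V := 'rV[R]_n.
Local Notation mu := (lebesgue_rV R n).
Variable zeta : V -> R[i].
Hypothesis hzeta : lp_cutoff zeta.

Let z1 : mem_Lp 1 zeta.
Proof. by case: hzeta => /schwartz_mem_Lp1. Qed.

Let mz : cmeasurable zeta := mem_Lp_meas z1.

(** On the Fourier side this is [fourier zeta] at [xi / 4], equal to 1 for [|xi| <= 4], minus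
    [fourier zeta] at [2 xi], zero for [|xi| >= 1]. The difference is 1 on the shell from 1 to 4,
    off which the transform of [lp_phi] vanishes. *)
Definition lp_chi (x : V) : R[i] := dilate 4^-1 zeta x - dilate 2 zeta x.

Lemma mem_Lp1_lp_phi : mem_Lp 1 (lp_phi zeta).
Proof.
by apply: mem_LpB => //; apply: mem_Lp1_dilate.
Qed.

Lemma mem_Lp1_lp_chi : mem_Lp 1 lp_chi.
Proof. by apply: mem_LpB => //; apply: mem_Lp1_dilate. Qed.

Lemma cint_lp_chi : cint mu lp_chi = 0.
Proof.
have i4 : 0 < 4^-1 :> R by rewrite invr_gt0.
by rewrite /lp_chi cintB ?cint_dilate ?subrr//; apply/mem_Lp1P; exact: mem_Lp1_dilate.
Qed.

Lemma enormZ (c : R) (x : V) : 0 <= c -> enorm (c *: x) = c * enorm x.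
Proof.
move=> c0; rewrite /enorm dotZl dotC dotZl mulrA -expr2 sqrtrM ?sqr_ge0//.
by rewrite sqrtr_sqr ger0_norm.
Qed.

Lemma fourier_lp_phi_chi xi :
  fourier (lp_phi zeta) xi * fourier lp_chi xi = fourier (lp_phi zeta) xi.
Proof.
have [_ zsupp [U [_ U1 zU]]] := hzeta.
have Z1 x : enorm x <= 1 -> fourier zeta x = 1 by move=> x1; apply: zU; exact: U1.
have Z0 x : 2 <= enorm x -> fourier zeta x = 0.
  move=> x2; apply/eqP/negPn/negP => zx0.
  have : enorm x < 2 by apply: zsupp; apply: subset_closure.
  by rewrite ltNge x2.
have i2 : 0 < 2^-1 :> R by rewrite invr_gt0.
have i4 : 0 < 4^-1 :> R by rewrite invr_gt0.
have -> : fourier (lp_phi zeta) xi = fourier zeta (2^-1 *: xi) - fourier zeta xi.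
  by rewrite /lp_phi fourierB ?fourier_dilate//; exact: mem_Lp1_dilate.
have -> : fourier lp_chi xi = fourier zeta (4^-1 *: xi) - fourier zeta (2 *: xi).
  by rewrite /lp_chi fourierB ?fourier_dilate//; exact: mem_Lp1_dilate.
have [x1|x1] := leP (enorm xi) 1.
  by rewrite (Z1 xi x1) (Z1 (2^-1 *: xi)) ?subrr ?mul0r// (enormZ _ (ltW i2)); lra.
rewrite (Z0 (2 *: xi)) ?enormZ//; last lra.
have [x4|x4] := leP (enorm xi) 4.
  by rewrite (Z1 (4^-1 *: xi)) ?subr0 ?mulr1// (enormZ _ (ltW i4)); lra.
by rewrite (Z0 xi) ?(Z0 (2^-1 *: xi)) ?subrr ?mul0r// ?(enormZ _ (ltW i2)); lra.
Qed.

(** The transforms of both sides agree, and injectivity turns this into an equality of functions,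
    hence only almost everywhere. *)
Lemma conv_lp_phi_chi t : 0 < t -> {ae mu, forall x,
  convolution (dilate t (lp_phi zeta)) (dilate t lp_chi) x = dilate t (lp_phi zeta) x}.
Proof.
move=> t0.
have p1 := mem_Lp1_lp_phi; have c1 := mem_Lp1_lp_chi.
have mp := mem_Lp_meas p1; have mc := mem_Lp_meas c1.
have pt1 := mem_Lp1_dilate t0 p1; have ct1 := mem_Lp1_dilate t0 c1.
have pc1 := mem_Lp_conv (lexx 1%E) pt1 ct1.
have := fourier_inj hzeta z1 (mem_LpB (lexx 1%E) pc1 pt1).
have H xi : fourier (fun x => convolution (dilate t (lp_phi zeta)) (dilate t lp_chi) x -
    dilate t (lp_phi zeta) x) xi = 0.
  rewrite (fourierB _ pc1 pt1) (fourier_conv _ pt1 ct1) (fourier_dilate _ t0 mp).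
  rewrite (fourier_dilate _ t0 mc).
  by rewrite fourier_lp_phi_chi subrr.
move=> /(_ H); apply: filterS => x /eqP; rewrite subr_eq0 => /eqP.
by [].
Qed.

Variable rho : V -> R[i].
Hypothesis rho1 : mem_Lp 1 rho.

Lemma Lpnorm_chi_rho_small : exists2 d0 : R, 0 < d0 & forall e t, 0 < e -> 0 < t ->
  t <= d0 * e ->
  (Lpnorm 1 (convolution (dilate t lp_chi) (dilate e rho)) <= (2^-1)%:E)%E.
Proof.
have c1 := mem_Lp1_lp_chi.
have mc := mem_Lp_meas c1; have mr := mem_Lp_meas rho1.
have i2 : 0 < 2^-1 :> R by rewrite invr_gt0.
(* Here [rho] is the function and [lp_chi] the kernel that concentrates. *)
have [d0 d00 H] := approximate_identity rho1 c1 i2.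
exists d0 => // e t e0 t0 te.
have te0 : 0 < t / e by rewrite divr_gt0.
have -> : dilate t lp_chi = dilate e (dilate (t / e) lp_chi).
  by rewrite dilateM mulrCA mulfV ?gt_eqF// mulr1.
have mct := cmeasurable_dilate (t / e) mc.
rewrite (conv_dilate e0 mct mr) (Lpnorm1_dilate e0 (cmeasurable_conv mct mr)).
rewrite (convC mct mr).
have := H (t / e) te0; rewrite ler_pdivrMr// => /(_ te).
rewrite cint_lp_chi (_ : (fun x => _ - 0 * rho x) =
  convolution rho (dilate (t / e) lp_chi))//.
by apply/funext => x; rewrite mul0r subr0.
Qed.

Lemma lp_block_le (p : \bar R) (f : V -> R[i]) e t : (1 <= p)%E -> mem_Lp p f ->
  0 < e -> 0 < t ->
  (Lpnorm 1 (convolution (dilate t lp_chi) (dilate e rho)) <= (2^-1)%:E)%E ->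
  (Lpnorm p (convolution f (dilate t (lp_phi zeta))) <=
   2%:E * Lpnorm 1 (lp_phi zeta) *
   Lpnorm p (fun x => (f x - convolution f (dilate e rho) x)%R))%E.
Proof.
move=> p1 fp e0 t0 small.
set eta := dilate t (lp_phi zeta); set X := dilate t lp_chi; set r := dilate e rho.
have eta1 : mem_Lp 1 eta by exact: (mem_Lp1_dilate t0 mem_Lp1_lp_phi).
have X1 : mem_Lp 1 X by exact: (mem_Lp1_dilate t0 mem_Lp1_lp_chi).
have r1 : mem_Lp 1 r by exact: (mem_Lp1_dilate e0 rho1).
have le11 := lexx (1 : \bar R)%E.
have Xr1 := mem_Lp_conv le11 X1 r1.
have fr := mem_Lp_conv p1 fp r1.
have feta := mem_Lp_conv p1 fp eta1.
have D := mem_LpB p1 fp fr.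
have mm := @mem_Lp_meas R n.
(* Commutativity, the insertion of [X] in [eta] and associativity identify the two right factors
   almost everywhere; after convolution with [f] the equality holds at every point. *)
have E1 : convolution f (convolution r eta) =
          convolution f (convolution eta (convolution X r)).
  apply: ae_eq_convr; [exact: mm fp|by apply: cmeasurable_conv; [exact: mm r1|exact: mm eta1]
    |by apply: cmeasurable_conv; [exact: mm eta1|exact: mm Xr1]|].
  rewrite (convC (mm _ _ r1) (mm _ _ eta1)).
  rewrite -(ae_eq_convl _ _ _ (conv_lp_phi_chi t0)).
  - exact: (ae_convA le11 eta1 X1 r1).
  - by apply: cmeasurable_conv; [exact: mm eta1|exact: mm X1].
  - exact: mm eta1.
  - exact: mm r1.
have key : {ae mu, forall x, convolution f eta x =
    convolution (fun y => f y - convolution f r y) eta x +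
    convolution (convolution f eta) (convolution X r) x}.
  have H1 := ae_convBl p1 fp fr eta1.
  have H2 := ae_convA p1 fp r1 eta1.
  have H3 := ae_convA p1 fp eta1 Xr1.
  apply: filterS3 H1 H2 H3 => x h1 h2 h3.
  by rewrite h1 h2 E1 h3 subrK.
have m1 : cmeasurable (convolution (fun y => f y - convolution f r y) eta).
  by apply: cmeasurable_conv; [exact: mm D|exact: mm eta1].
have m2 : cmeasurable (convolution (convolution f eta) (convolution X r)).
  by apply: cmeasurable_conv; [exact: mm feta|exact: mm Xr1].
have : (Lpnorm p (convolution f eta) <=
    Lpnorm p (fun x => (f x - convolution f r x)%R) * Lpnorm 1 (lp_phi zeta) +
    Lpnorm p (convolution f eta) * (2^-1)%:E)%E.
  rewrite {1}(ae_eq_Lpnorm p1 (mm _ _ feta) (cmeasurableD m1 m2) key).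
  apply: le_trans (Lpnorm_triangle p1 m1 m2) _; apply: leeD.
    apply: le_trans (Lpnorm_conv_le p1 D eta1) _.
    by rewrite (Lpnorm1_dilate t0 (mm _ _ mem_Lp1_lp_phi)).
  apply: le_trans (Lpnorm_conv_le p1 feta Xr1) _.
  exact: (lee_wpmul2l (Lpnorm_ge0 _ _) small).
(* The three memberships supply the finiteness needed for the absorption. *)
have [_ _ foo] := feta; have [_ _ Doo] := D; have [_ _ poo] := mem_Lp1_lp_phi.
move: foo Doo poo; apply: le_half_absorb; exact: Lpnorm_ge0.
Qed.

End littlewood_paley_blocks.

(** * Summation over dyadic scales *)

(* The integral of a nonnegative function is a supremum over simple functions,
   so no measurability is needed. *)
Lemma ge0_le_integral_nonmeasurable d (T : measurableType d) (R : realType)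
    (mu : {measure set T -> \bar R}) (D : set T) (f g : T -> \bar R) :
  (forall x, D x -> 0 <= f x)%E -> (forall x, D x -> f x <= g x)%E ->
  (\int[mu]_(x in D) f x <= \int[mu]_(x in D) g x)%E.
Proof.
move=> f0 fg.
rewrite !ge0_integralE//; last by move=> x Dx; exact: le_trans (f0 _ Dx) (fg _ Dx).
apply: ereal_sup_le => _ [h hf <-]; exists h => // x.
apply: le_trans (hf x) _; rewrite !patchE; case: ifPn => // xD.
by apply: fg; exact: set_mem.
Qed.

Section dyadic_sum.
Variables (R : realType) (s q A B d0 : R).
Hypotheses (s0 : 0 < s) (q1 : 1 <= q) (A0 : 0 <= A) (B0 : 0 < B) (d00 : 0 < d0).

(** The smallness condition [2^-k <= d0 e] reads [e >= c 2^-k], which fixes where [level k] begins.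
    [J] exceeds [2 c], so [2 c <= 2^k] for [k >= J] and these levels stay below 1. *)
Let c := d0^-1.
Let J := (Num.truncn (2 * c)).+1.
(* [K k] bounds [e^(s q + 1)] for [e] in [level k], an interval of length [c 2^-k];
   [C1] is what makes [weight_eq] true. *)
Let C1 := B `^ q * 2 `^ (s * q) * (2 * c) `^ (s * q + 1) / c.
Let K k := (2 * c * 2 ^- k) `^ (s * q + 1).

Let c0 : 0 < c. Proof. by rewrite invr_gt0. Qed.

Let q0 : 0 < q. Proof. exact: lt_le_trans q1. Qed.

Let tau0 k : 0 < 2 ^- k :> R. Proof. by rewrite invr_gt0 exprn_gt0. Qed.

Let C10 : 0 <= C1.
Proof. by apply: divr_ge0; [rewrite !mulr_ge0 ?powR_ge0|exact: ltW]. Qed.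

Let K0 k : 0 < K k.
Proof. by rewrite powR_gt0// !mulr_gt0. Qed.

Let leJ k : (J <= k)%N -> 2 * c * 2 ^- k <= 1.
Proof.
move=> Jk; rewrite ler_pdivrMr ?exprn_gt0// mul1r.
apply: (@le_trans _ _ J%:R); first by apply: ltW; exact: truncnS_gt.
by rewrite -natrX ler_nat (leq_trans Jk)// ltnW// ltn_expl.
Qed.

Let level k : set R := `]c * 2 ^- k, 2 * c * 2 ^- k[%classic.

Let level_sub k : (J <= k)%N -> level k `<=` `]0, 1[%classic.
Proof.
move=> /leJ Jk x; rewrite /level /= !in_itv/= => /andP[x1 x2].
rewrite (lt_le_trans x2 Jk) andbT.
by apply: lt_trans x1; exact: mulr_gt0.
Qed.

Let level_disj k l e : level k e -> level l e -> k = l.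
Proof.
wlog kl : k l / (k <= l)%N.
  by move=> H; case: (leqP k l) => [/H//|/ltnW/H H' a b]; apply/esym/H'.
rewrite /level /= !in_itv/= => /andP[x1 x2] /andP[y1 y2].
apply/eqP; rewrite eqn_leq kl /= leqNgt; apply/negP => kl'.
have : 2 * c * 2 ^- l <= c * 2 ^- k.
  rewrite [2 * c]mulrC -mulrA ler_pM2l//.
  rewrite -(subnKC kl') exprD exprS !invfM mulrA mulVKf//.
  by rewrite ler_piMr ?invf_le1 ?exprn_gt0 ?exprn_ege1 ?ler1n// ltW.
by move=> /(lt_le_trans y2)/lt_trans/(_ x1); rewrite ltxx.
Qed.

(** [K k] contains [2^-k] to the power [s q + 1]; the length [c 2^-k] of [level k] cancels the extra
    1 and leaves [2^(k s q)]. Block [k.+1] lives at scale [2^-k], and this shift of index is the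
    factor [2^(s q)] of [C1]. *)
Let weight_eq k (N : R) : 0 <= N ->
  2 `^ (s * k.+1%:R * q) * N `^ q =
  C1 * (N `^ q / (B `^ q * K k) * (c * 2 ^- k)).
Proof.
move=> N0; rewrite /C1 /K.
have tE : (2 ^- k : R) = 2 `^ (- k%:R) by rewrite powR_invn.
have t0' : (0 : R) <= 2 ^- k by exact: ltW.
have c20 : 0 <= 2 * c by rewrite mulr_ge0// ltW.
rewrite (@powRM _ (2 * c) (2 ^- k) (s * q + 1))//.
rewrite (@powRD _ (2 ^- k) (s * q) 1); last by rewrite (gt_eqF (tau0 k)) implybT.
rewrite powRr1// {1}tE -powRrM.
have -> : s * k.+1%:R * q = s * q + k%:R * (s * q) by rewrite -addn1 natrD; ring.
rewrite [2 `^ (_ + _)]powRD; last by rewrite pnatr_eq0 implybT.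
rewrite mulNr powRN.
have u0 : 2 `^ (k%:R * (s * q)) != 0 :> R by rewrite gt_eqF// powR_gt0.
have v0 : B `^ q != 0 by rewrite gt_eqF// powR_gt0.
have w0 : (2 * c) `^ (s * q + 1) != 0 by rewrite gt_eqF// powR_gt0// mulr_gt0.
have t0 : 2 ^- k != 0 :> R by rewrite gt_eqF.
have cn0 : c != 0 by rewrite gt_eqF.
move: u0 v0 w0 t0 cn0.
set u := 2 `^ _; set v := B `^ q; set w := (2 * c) `^ _; set t := 2 ^- k.
by move=> *; field; apply/and5P.
Qed.

(** [N j] stands for the norm of block [j], [P] for that of [f] and [D e] for that of
    [f - f * rho_e]. [C] is chosen before all three, hence uniformly in [f]. *)
Lemma dyadic_sum_le : exists2 C : R, 0 <= C &
  forall (N : nat -> R) (D : R -> \bar R) (P : R),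
  0 <= P -> (forall j, 0 <= N j) -> (forall e, 0 <= D e)%E ->
  (forall j, N j <= A * P) ->
  (forall k e, 0 < e -> 2 ^- k <= d0 * e -> ((N k.+1)%:E <= B%:E * D e)%E) ->
  (\sum_(0 <= j <oo) ((2 `^ (s * j%:R * q))%:E * (N j)%:E `^ q) <=
   C%:E * (P%:E `^ q + \int[lebesgue_measure]_(e in `]0%R, 1%R[)
     ((1 / e `^ (s * q + 1))%:E * D e `^ q)))%E.
Proof.
(* Pays for blocks 0 to [J] by [P]: block 0 has no level attached, and block [k.+1] uses [level k],
   which may leave []0, 1[] when [k < J]. *)
pose C2 := \sum_(j < J.+1) 2 `^ (s * j%:R * q) * A `^ q.
have C20 : 0 <= C2 by apply: sumr_ge0 => j _; rewrite mulr_ge0// powR_ge0.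
exists (C2 + C1) => [|N D P P0 N0 D0 NA ND]; first exact: addr_ge0.
pose t j := 2 `^ (s * j%:R * q) * N j `^ q.
have t0 j : 0 <= t j by rewrite mulr_ge0// powR_ge0.
under eq_eseriesr do rewrite poweR_EFin -EFinM.
set I := (\int[_]_(_ in _) _)%E.
have W0 e : (0 <= (1 / e `^ (s * q + 1))%:E * D e `^ q)%E.
  by apply: mule_ge0; rewrite ?poweR_ge0// lee_fin divr_ge0// powR_ge0.
have I0 : (0 <= I)%E by apply: integral_ge0 => e _.
apply: lime_le; first by apply: is_cvg_nneseries => j _ _; rewrite lee_fin t0.
apply: nearW => m; rewrite big_mkord.
(* A lower bound for the integrand on [level (J + i)]: there [D e] is at least [N (J + i).+1 / B],
   and [e] to the power [s q + 1] is at most [K (J + i)]. *)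
pose a i := N (J + i).+1 `^ q / (B `^ q * K (J + i)).
have a0 i : 0 <= a i by rewrite divr_ge0 ?powR_ge0// mulr_ge0 ?powR_ge0// ltW.
have step : ((\sum_(i < m) a i * (c * 2 ^- (J + i)))%:E <= I)%E.
  pose g (e : R) := \sum_(i < m) a i * \1_(level (J + i)) e.
  apply: (@le_trans _ _ (\int[lebesgue_measure]_(e in `]0%R, 1%R[) (g e)%:E)%E).
    have mL k : measurable (level k : set (measurableTypeR R)) by exact: measurable_itv.
    have mD : measurable (`]0, 1[%classic : set (measurableTypeR R)) by exact: measurable_itv.
    have muL k : lebesgue_measure (level k) = (c * 2 ^- k)%:E.
      have ct : 0 < c * 2 ^- k by exact: mulr_gt0.
      rewrite /level lebesgue_measure_itv/= lte_fin.
      by rewrite ifT; [rewrite -EFinB; congr EFin; ring|lra].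
    rewrite le_eqVlt; apply/orP; left; apply/eqP; apply/esym.
    under eq_integral do rewrite /g -sumEFin.
    rewrite ge0_integral_sum//; last 2 first.
    - by move=> i; apply/measurable_EFinP; apply: measurable_funM.
    - by move=> i e _; rewrite lee_fin mulr_ge0.
    rewrite -sumEFin; apply: eq_bigr => i _.
    under eq_integral do rewrite (EFinM (a i)).
    rewrite ge0_integralZl//.
    - rewrite integral_indic// [RHS]EFinM -muL; congr (_ * _)%E.
      by congr (lebesgue_measure _); apply: setIidl; apply: level_sub; exact: leq_addr.
    - by apply/measurable_EFinP; exact: (measurable_indic (mL _)).
    - by rewrite lee_fin.
  apply: ge0_le_integral_nonmeasurable => [e _|e e01].
    by rewrite lee_fin; apply: sumr_ge0 => i _; rewrite mulr_ge0.
  (* The levels being disjoint, at most one term of [g e] is nonzero. *)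
  have [[i ei]|nei] := pselect (exists i : 'I_m, level (J + i) e); last first.
    rewrite /g big1 ?W0// => i _; rewrite indicE memNset ?mulr0// => ei.
    by apply: nei; exists i.
  rewrite /g (bigD1 i)//= big1 => [|l li]; last first.
    rewrite indicE memNset ?mulr0// => /(level_disj ei)/addnI/ord_inj il.
    by rewrite il eqxx in li.
  rewrite addr0 indicE mem_set// mulr1.
  move: ei; rewrite /level /= in_itv/= => /andP[e1 e2].
  have e0 : 0 < e by apply: lt_trans e1; exact: mulr_gt0.
  have h : 2 ^- (J + i) <= d0 * e.
    by rewrite -ler_pdivrMl// ltW// mulrC -/c mulrC.
  have Dq0 : (0 <= D e `^ q)%E by exact: poweR_ge0.
  have NqD : ((N (J + i).+1 `^ q)%:E <= (B `^ q)%:E * D e `^ q)%E.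
    rewrite -!poweR_EFin -poweRM ?lee_fin ?(ltW B0)//.
    by apply: gt0_le_poweR => //; [rewrite lee_fin|exact: ND].
  have Bq0 : B `^ q != 0 by rewrite gt_eqF// powR_gt0.
  have BK0 : 0 <= (B `^ q * K (J + i))^-1 by rewrite invr_ge0 mulr_ge0 ?powR_ge0// ltW.
  rewrite /a mulrC EFinM; apply: (@le_trans _ _
    (((B `^ q * K (J + i))^-1)%:E * ((B `^ q)%:E * D e `^ q))%E).
    by apply: lee_wpmul2l => //; rewrite lee_fin.
  rewrite muleA -EFinM; apply: lee_wpmul2r => //; rewrite lee_fin.
  rewrite invfM mulrAC mulVf// mul1r div1r lef_pV2 ?posrE ?K0 ?powR_gt0//.
  apply: ge0_ler_powR; rewrite ?nnegrE.
  - by rewrite addr_ge0// mulr_ge0// ltW.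
  - exact: ltW.
  - by rewrite !mulr_ge0// ltW.
  - exact: ltW.
(* Lengthening the partial sum by nonnegative terms makes it split after block [J], whatever [m]
   is. *)
apply: (@le_trans _ _ (\sum_(j < J.+1 + m) (t j)%:E)%E).
  rewrite !sumEFin lee_fin -!(big_mkord xpredT t).
  by rewrite [leRHS](@big_cat_nat _ _ _ m) ?leq_addl//= lerDl sumr_ge0.
rewrite sumEFin big_split_ord /= EFinD.
have Pq0 : (0 <= P%:E `^ q)%E by exact: poweR_ge0.
rewrite ge0_muleDr//; apply: leeD.
  apply: (@le_trans _ _ (C2%:E * P%:E `^ q)%E); last first.
    by apply: lee_wpmul2r => //; rewrite lee_fin lerDl.
  rewrite poweR_EFin -EFinM lee_fin /C2 mulr_suml; apply: ler_sum => j _.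
  rewrite -[leRHS]mulrA; apply: ler_wpM2l; first exact: powR_ge0.
  rewrite -powRM//.
  by apply: ge0_ler_powR; rewrite ?nnegrE ?mulr_ge0// ltW.
apply: (@le_trans _ _ (C1%:E * I)%E); last first.
  by apply: lee_wpmul2r => //; rewrite lee_fin lerDr.
have <- : C1 * (\sum_(i < m) a i * (c * 2 ^- (J + i))) = \sum_(i < m) t (J.+1 + i)%N.
  rewrite mulr_sumr; apply: eq_bigr => i _.
  by rewrite /t addSn weight_eq.
by rewrite EFinM; apply: lee_wpmul2l => //; rewrite lee_fin.
Qed.

End dyadic_sum.

(** * Powers of the Besov norm, and the final estimate *)

Lemma poweRVK (R : realType) (q : R) (x : \bar R) : 0 < q -> (0 <= x)%E ->
  ((x `^ q^-1) `^ q = x)%E.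
Proof. by move=> q0 x0; rewrite -poweRrM mulVf ?gt_eqF// poweRe1. Qed.

Lemma besov_norm_poweR (R : realType) (n : nat) (zeta : 'rV[R]_n -> R[i]) s p (q : R) f :
  0 < q -> (besov_norm zeta s p q f `^ q = Lpnorm p f `^ q +
    \sum_(0 <= j <oo) (2 `^ (s * j%:R * q))%R%:E * Lpnorm p (lp_block zeta f j) `^ q)%E.
Proof.
move=> q0; rewrite /besov_norm poweRVK//; last first.
  by apply: adde_ge0; exact: poweR_ge0.
rewrite /besov_seminorm poweRVK//; apply: nneseries_ge0 => j _ _.
by apply: mule_ge0; [rewrite lee_fin powR_ge0|exact: poweR_ge0].
Qed.

Theorem theorem1p1 (R : realType) (n : nat) (hn : (0 < n)%N)
    (zeta : 'rV[R]_n -> R[i]) (hzeta : lp_cutoff zeta)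
    (rho : 'rV[R]_n -> R[i]) (hrho : mem_Lp 1%E rho)
    (hrho1 : cintegral rho = 1)
    (s : R) (hs : 0 < s) (p : \bar R) (hp : (1 <= p)%E)
    (q : R) (hq : 1 <= q) :
  exists2 C : R, 0 <= C &
    forall f : 'rV[R]_n -> R[i], mem_Lp p f ->
      (besov_norm zeta s p q f `^ q <=
       C%:E * (Lpnorm p f `^ q +
         \int[lebesgue_measure]_(e in `]0%R, 1%R[)
           ((1 / e `^ (s * q + 1))%R%:E *
            Lpnorm p (fun x => (f x - convolution f (dilate e rho) x)%R) `^ q)))%E.
Proof.
have z1 : mem_Lp 1 zeta by case: hzeta => /schwartz_mem_Lp1.
have phi1 := mem_Lp1_lp_phi hzeta.
have q0 : 0 < q := lt_le_trans ltr01 hq.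
have finE (r : \bar R) (g : 'rV[R]_n -> R[i]) : mem_Lp r g ->
    exists2 x : R, 0 <= x & Lpnorm r g = x%:E.
  move=> [_ _ goo]; have g0 := Lpnorm_ge0 r g.
  exists (fine (Lpnorm r g)); first exact: (fine_ge0 g0).
  by apply/esym/fineK; rewrite ge0_fin_numE.
have [a a0 aE] := finE _ _ z1; have [b b0 bE] := finE _ _ phi1.
have [d0 d00 small] := Lpnorm_chi_rho_small hzeta hrho.
(* By Young, [a] controls block 0, whose kernel is [zeta], and [b] all others, whose kernels are
   dilates of [lp_phi zeta]; the sum serves for both. In [2 * b + 1] the 1 ensures positivity if
   [b = 0]. *)
have ab0 : 0 <= a + b := addr_ge0 a0 b0.
have B0 : 0 < 2 * b + 1 by lra.
have [C C0 CP] := dyadic_sum_le hs hq ab0 B0 d00.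
(* The 1 accounts for the [L^p] term of the Besov norm, [C] for the sum over blocks. *)
exists (1 + C) => [|f fp]; first exact: addr_ge0.
have [P P0 PE] := finE _ _ fp.
have tau0 k : 0 < 2 ^- k :> R by rewrite invr_gt0 exprn_gt0.
have dphi1 k := mem_Lp1_dilate (tau0 k) phi1.
have blk j : mem_Lp p (lp_block zeta f j).
  by case: j => [|k]; [exact: (mem_Lp_conv hp fp z1)|exact: (mem_Lp_conv hp fp (dphi1 k))].
pose N j := fine (Lpnorm p (lp_block zeta f j)).
have NE j : Lpnorm p (lp_block zeta f j) = (N j)%:E.
  by rewrite /N; have [x _ ->] := finE _ _ (blk j).
have N0 j : 0 <= N j by rewrite fine_ge0// Lpnorm_ge0.
pose D e := Lpnorm p (fun x => f x - convolution f (dilate e rho) x).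
have D0 e : (0 <= D e)%E := Lpnorm_ge0 _ _.
have NA j : N j <= (a + b) * P.
  rewrite -lee_fin -NE; apply: (@le_trans _ _ (P%:E * (a + b)%:E)%E); last first.
    by rewrite -EFinM mulrC.
  have P0' : (0 <= P%:E)%E by rewrite lee_fin.
  case: j => [|k].
    apply: le_trans (Lpnorm_conv_le hp fp z1) _; rewrite PE aE.
    by apply: lee_wpmul2l => //; rewrite lee_fin lerDl.
  apply: le_trans (Lpnorm_conv_le hp fp (dphi1 k)) _.
  rewrite PE (Lpnorm1_dilate (tau0 k) (mem_Lp_meas phi1)) bE.
  by apply: lee_wpmul2l => //; rewrite lee_fin lerDr.
have ND k e : 0 < e -> 2 ^- k <= d0 * e -> ((N k.+1)%:E <= (2 * b + 1)%:E * D e)%E.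
  move=> e0 ke; rewrite -NE.
  apply: le_trans (lp_block_le hzeta hrho hp fp e0 (tau0 k) (small _ _ e0 (tau0 k) ke)) _.
  rewrite bE -EFinM; apply: (lee_wpmul2r (D0 e)).
  by rewrite lee_fin lerDl.
rewrite (besov_norm_poweR _ _ _ _ q0); under eq_eseriesr do rewrite NE.
have /= := CP N D P P0 N0 D0 NA ND; rewrite PE /D.
set S := (\sum_(0 <= j <oo) _)%E; set I := (\int[_]_(_ in _) _)%E => SI.
have I0 : (0 <= I)%E.
  apply: integral_ge0 => e _; apply: mule_ge0; last exact: poweR_ge0.
  by rewrite lee_fin divr_ge0// powR_ge0.
have Pq0 : (0 <= P%:E `^ q)%E := poweR_ge0 _ _.
rewrite EFinD ge0_muleDl ?lee_fin// mul1e; apply: leeD SI.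
by rewrite leeDl.
Qed.
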